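(* Let $0<\beta<1$ and $\lambda>0$. Let $N_1(t)$, $t\ge 0$, be a Poisson process with rate $\lambda$, and let $E(t)$ be the inverse of a standard $\beta$-stable subordinator $D(t)$, independent of $N_1$. Then the fractal time Poisson process $N_1(E(t))$ is also a fractional Poisson process: the waiting times between its jumps are independent and identically distributed random variables $X_1,X_2,\dots$ with the Mittag-Leffler distribution $$\mathbb P(X_n>t)=E_\beta(-\lambda t^\beta),\qquad t\ge 0.$$
   Context: The standard $\beta$-stable subordinator $D(t)$, $t\ge 0$, is the nondecreasing Lévy process (càdlàg paths, $D(0)=0$) with $\mathbb E[e^{-sD(t)}]=e^{-ts^\beta}$ for $s\ge 0$. Its inverse is $E(t)=\inf\{r>0: D(r)>t\}$, $t\ge 0$. The Mittag-Leffler function is $E_\beta(z)=\sum_{k=0}^\infty \frac{z^k}{\Gamma(1+\beta k)}$ (not to be confused with the process $E(t)$). The fractional Poisson process with parameters $\beta,\lambda$ is the renewal process $N_\beta(t)=\max\{n\ge 0: T_n\le t\}$, where $T_0=0$, $T_n=J_1+\cdots+J_n$, and $(J_n)$ are IID with $\mathbb P(J_n>t)=E_\beta(-\lambda t^\beta)$ for $t\ge 0$. The jump times of $N_1(E(t))$ are $\tau_n=\sup\{t>0: N_1(E(t))<n\}$ for $n\ge 1$, and the waiting times between its jumps are $X_1=\tau_1$ and $X_n=\tau_n-\tau_{n-1}$ for $n\ge 2$. *)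

(* Defs.v *)
From HB Require Import structures.
From mathcomp Require Import all_boot all_order all_algebra.
From mathcomp Require Import all_classical all_reals all_analysis.

Set Implicit Arguments.
Unset Strict Implicit.
Unset Printing Implicit Defensive.

Import Order.TTheory GRing.Theory Num.Theory.
Import numFieldNormedType.Exports.

Local Open Scope classical_set_scope.
Local Open Scope ring_scope.

Definition Gamma {R : realType} (x : R) : R :=
  \int[lebesgue_measure]_(u in `]0, +oo[) (u `^ (x - 1) * expR (- u)).

Definition mittag_leffler {R : realType} (beta z : R) : R :=
  limn (series (fun k : nat => z ^+ k / Gamma (1 + beta * k%:R))).

(* Mutual independence: the product rule over every finite subfamily. *)
Definition mutually_independent {R : realType} {d : measure_display}
    {T : measurableType d} (P : probability T R) (I : eqType)
    (X : I -> T -> R) : Prop :=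
  forall (s : seq I) (B : I -> set R), uniq s ->
    (forall i, measurable (B i)) ->
    P [set w | forall i, i \in s -> B i (X i w)] =
    (\prod_(i <- s) P (X i @^-1` B i))%E.

(* Stochastic processes are families indexed by R of which only the times
   t >= 0 are meaningful. *)

Definition process_sigma_algebra {R : realType} {d d' : measure_display}
    {T : measurableType d} {S : measurableType d'} (X : R -> T -> S) :
    set (set T) :=
  <<s [set A | exists (t : R) (B : set S), [/\ 0 <= t, measurable B & A = X t @^-1` B]] >>.

Definition independent_processes {R : realType} {d d1 d2 : measure_display}
    {T : measurableType d} {S1 : measurableType d1} {S2 : measurableType d2}
    (P : probability T R) (X : R -> T -> S1) (Y : R -> T -> S2) : Prop :=
  forall A B : set T, process_sigma_algebra X A -> process_sigma_algebra Y B ->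
    P (A `&` B) = (P A * P B)%E.

Definition independent_increments {R : realType} {d : measure_display}
    {T : measurableType d} (P : probability T R) (X : R -> T -> R) : Prop :=
  forall (n : nat) (t : nat -> R), 0 <= t 0%N ->
    (forall i, (i < n)%N -> t i <= t i.+1) ->
    mutually_independent P
      (fun (i : 'I_n) (w : T) => X (t i.+1) w - X (t i) w).

Definition stationary_increments {R : realType} {d : measure_display}
    {T : measurableType d} (P : probability T R) (X : R -> T -> R) : Prop :=
  forall (s t : R) (B : set R), 0 <= s -> 0 <= t -> measurable B ->
    P [set w | B (X (s + t) w - X s w)] = P [set w | B (X t w - X 0 w)].

Definition cadlag {R : realType} (f : R -> R) : Prop :=
  forall t : R, 0 <= t ->
    f x @[x --> t^'+] --> f t /\ (0 < t -> cvg (f x @[x --> t^'-])).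

Definition levy_process {R : realType} {d : measure_display}
    {T : measurableType d} (P : probability T R) (X : R -> T -> R) : Prop :=
  [/\ forall t : R, 0 <= t -> measurable_fun setT (X t),
      forall w, X 0 w = 0,
      forall w, cadlag (X ^~ w),
      independent_increments P X &
      stationary_increments P X].

Definition stable_subordinator {R : realType} {d : measure_display}
    {T : measurableType d} (P : probability T R) (beta : R)
    (D : R -> T -> R) : Prop :=
  [/\ levy_process P D,
      forall w (s t : R), 0 <= s -> s <= t -> D s w <= D t w &
      forall s t : R, 0 <= s -> 0 <= t ->
        expectation P (fun w => expR (- s * D t w)) =
        (expR (- t * s `^ beta))%:E].

(* The pmf is used at positive time lags only: [poisson_pmf 0] is not the pmf
   of the Dirac mass at 0. *)
Definition poisson_process {R : realType} {d : measure_display}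
    {T : measurableType d} (P : probability T R) (lambda : R)
    (N : R -> T -> nat) : Prop :=
  [/\ forall t : R, 0 <= t -> measurable_fun setT (N t),
      forall w, N 0 w = 0%N,
      forall w, (forall s t : R, 0 <= s -> s <= t -> (N s w <= N t w)%N) /\
                cadlag (fun t => (N t w)%:R),
      independent_increments P (fun t w => (N t w)%:R) &
      forall (s t : R) (k : nat), 0 <= s -> s < t ->
        P [set w | (N t w - N s w)%N = k] =
        (poisson_pmf (lambda * (t - s)) k)%:E].

(* [inf] and [sup] on R return 0 on empty or unbounded sets; for a stable
   subordinator and a Poisson process the sets below are almost surely
   nonempty and bounded (except for n = 0 in [jump_time]). *)

Definition inverse_process {R : realType} {T : Type} (D : R -> T -> R)
    (t : R) (w : T) : R :=
  inf [set r | 0 < r /\ t < D r w].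

Definition time_change {R : realType} {T : Type} (N : R -> T -> nat)
    (E : R -> T -> R) (t : R) (w : T) : nat :=
  N (E t w) w.

Definition jump_time {R : realType} {T : Type} (N : R -> T -> nat)
    (n : nat) (w : T) : R :=
  sup [set t | 0 < t /\ (N t w < n)%N].

(* Zero-based: [waiting_time N n] is the (n+1)-st waiting time X_{n+1}. *)
Definition waiting_time {R : realType} {T : Type} (N : R -> T -> nat)
    (n : nat) (w : T) : R :=
  if n is 0%N then jump_time N 1 w
  else jump_time N n.+1 w - jump_time N n w.

Definition iid_mittag_leffler {R : realType} {d : measure_display}
    {T : measurableType d} (P : probability T R) (beta lambda : R)
    (J : nat -> T -> R) : Prop :=
  [/\ forall n, measurable_fun setT (J n),
      mutually_independent P J &
      forall n (t : R), 0 <= t ->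
        P [set w | t < J n w] =
        (mittag_leffler beta (- lambda * t `^ beta))%:E].

(* [N t w] is the largest n with J_1 + ... + J_n <= t, for all t >= 0
   simultaneously, almost surely. *)
Definition fractional_poisson_process {R : realType} {d : measure_display}
    {T : measurableType d} (P : probability T R) (beta lambda : R)
    (N : R -> T -> nat) : Prop :=
  exists J : nat -> T -> R, iid_mittag_leffler P beta lambda J /\
    {ae P, forall w, forall t : R, 0 <= t ->
      \sum_(i < N t w) J i w <= t /\
      forall m : nat, \sum_(i < m) J i w <= t -> (m <= N t w)%N}.

(* Main.v *)
(* N1(E(t)) < n iff D(r) > t for some r > 0 with N1(r) < n; hence the
   n-th jump time is tau_n = D(S_n-), where S_n is the n-th jump time of N1, and
   N1(E(t)) >= n iff tau_n <= t.

   To find the joint law of the X_n = tau_n - tau_(n-1), sample along the grid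
   of mesh h = 2^-k: mark the intervals (jh, (j+1)h] in which N1 jumps. The gaps
   between marks are i.i.d. geometric, independent of D, so the increments of D
   between the left ends of consecutive marked intervals are independent, with
   Laplace transform
     (1 - e^(-lambda h)) e^(- c h s^beta) / (1 - e^(- (lambda + s^beta) h)),
   where c = 0 for the first one and c = 1 for the others. Almost surely N1 has
   simple jumps, so as h -> 0 the left ends tend to the S_n from below and the
   increments tend to the X_n, whatever the jumps of D. Thus
   E e^(- s X_n) = lambda / (lambda + s^beta), which is the transform of the
   Mittag-Leffler law: int e^(-st) t^(beta k) dt = Gamma(1 + beta k) s^(-1-beta k)
   termwise, and Laplace transforms are injective by Bernstein approximation in
   the variable e^(-t). That law has no atoms, so the probabilities of half-lines
   converge and independence passes to the limit. *)

Require Import Defs.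
From HB Require Import structures.
From mathcomp Require Import all_boot all_order all_algebra.
From mathcomp Require Import all_classical all_reals all_analysis.
From mathcomp Require Import measurable_realfun ring lra zify.

Import Order.TTheory GRing.Theory Num.Theory.
Import numFieldNormedType.Exports.
Local Open Scope classical_set_scope.
Local Open Scope ring_scope.

Set Implicit Arguments.
Unset Strict Implicit.
Unset Printing Implicit Defensive.

(** * Uniqueness of Laplace transforms *)

(** The grid serves to make the sampling times of D deterministic. Once the gaps between the marks
    are prescribed, the event involves N1 and D at fixed times only, so independence of the two
    processes and of their increments applies directly; the prescribed gaps are then summed out one
    at a time. Left ends are sampled because N1 has not jumped yet there: the sampled value of D
    stays below tau_n = D(S_n-), while a right end would include the jump of D at S_n, if any.
    Simple jumps make the n-th mark belong to the n-th jump. The termwise transform of the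
    Mittag-Leffler function converges only for s^beta > lambda. Injectivity is therefore proved from
    the values at s0 + n alone, n a natural number, with s0 chosen inside this range. It is applied
    to the tail t -> P(X > t), whose transform is (1 - E e^(-sX)) / s: this avoids densities, and
    right-continuity of the tail turns almost everywhere equality into equality at every t. *)

Fixpoint bernstein {R : realType} (n : nat) (phi : nat -> R) : {poly R} :=
  if n is m.+1 then (1 - 'X) * bernstein m phi + 'X * bernstein m (phi \o S)
  else (phi 0%N)%:P.

(** Conditioning on the first of the tosses with success probability [y]: a success shifts [phi] by
    one. *)
Lemma horner_bernsteinS {R : realType} (n : nat) (phi : nat -> R) (y : R) :
  (bernstein n.+1 phi).[y] =
  (1 - y) * (bernstein n phi).[y] + y * (bernstein n (phi \o S)).[y].
Proof. by rewrite /= !hornerE. Qed.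

(* [bernstein n phi] at [y] is the expectation of [phi] under the binomial law
   with parameters [n] and [y]; here its second moment about [a]. *)
Lemma bernstein_quadratic {R : realType} (n : nat) (a b c y : R) :
  (bernstein n (fun k => c + b * (k%:R - a) ^+ 2)).[y] =
  c + b * (n%:R * y * (1 - y) + (n%:R * y - a) ^+ 2).
Proof.
elim: n a => [|n ih] a; first by rewrite /= hornerC; ring.
rewrite horner_bernsteinS ih.
rewrite (_ : _ \o S = (fun k => c + b * (k%:R - (a - 1)) ^+ 2)); last first.
  by apply/funext => k /=; rewrite -natr1; ring.
by rewrite ih -natr1; ring.
Qed.

Lemma le_bernstein {R : realType} (n : nat) (phi psi : nat -> R) (y : R) :
  0 <= y <= 1 -> (forall k, phi k <= psi k) ->
  (bernstein n phi).[y] <= (bernstein n psi).[y].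
Proof.
move=> y01; elim: n phi psi => [|n ih] phi psi le; first by rewrite /= !hornerC.
rewrite !horner_bernsteinS; move: y01 => /andP[y0 y1].
by rewrite lerD// ler_wpM2l ?subr_ge0// ih// => k; apply: le.
Qed.

(** Chebyshev's argument without probability: [f] lies between the quadratics f(y) -+ (e/2 + (x -
    y)^2/(2e)), on which the monotone Bernstein operator is explicit. *)
Lemma bernstein_cvg {R : realType} (f : R -> R) (y : R) :
  (forall a b, `|f a - f b| <= `|a - b|) -> 0 <= y <= 1 ->
  (bernstein n (fun k => f (k%:R / n%:R))).[y] @[n --> \oo] --> f y.
Proof.
move=> flip y01; have /andP[y0 y1] := y01.
apply/cvgrPdist_le => e e0.
near=> n.
have n0 : (0 : R) < n%:R by rewrite ltr0n; near: n; exact: nbhs_infty_gt.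
have ne2 : 1 / n%:R <= e ^+ 2 / 4.
  rewrite mul1r -[leRHS]invrK lef_pV2 ?posrE// ?invr_gt0 ?divr_gt0 ?exprn_gt0//.
  by near: n; exact: nbhs_infty_ger.
(* This is (e - |x|)^2 >= 0 divided by 2e; it trades the Lipschitz bound for a quadratic one. *)
have abound (x : R) : `|x| <= e / 2 + 1 / (2 * e) * x ^+ 2.
  rewrite -[x ^+ 2]real_normK ?num_real//.
  rewrite -(ler_pM2l (_ : 0 < 2 * e)) ?mulr_gt0//.
  have -> : 2 * e * (e / 2 + 1 / (2 * e) * `|x| ^+ 2) = e ^+ 2 + `|x| ^+ 2.
    by field; rewrite gt_eqF.
  have := sqr_ge0 (e - `|x|); rewrite sqrrB; lra.
have quad (s c : R) : (bernstein n (fun k => c + s * (e / 2 + 1 / (2 * e) *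
     (k%:R / n%:R - y) ^+ 2))).[y] = c + s * (e / 2 + y * (1 - y) / (2 * e * n%:R)).
  rewrite (_ : (fun _ => _) = (fun k => (c + s * (e / 2)) +
    (s / (2 * e * n%:R ^+ 2)) * (k%:R - n%:R * y) ^+ 2)); last first.
    by apply/funext => k; field; rewrite !gt_eqF.
  by rewrite bernstein_quadratic; field; rewrite !gt_eqF.
have small : e / 2 + y * (1 - y) / (2 * e * n%:R) <= e.
  suff : y * (1 - y) / (2 * e * n%:R) <= e / 2 by lra.
  have -> : y * (1 - y) / (2 * e * n%:R) = (y * (1 - y)) * (1 / n%:R) / (2 * e).
    by field; rewrite !gt_eqF.
  rewrite ler_pdivrMr ?mulr_gt0//.
  apply: (@le_trans _ _ (1 * (1 / n%:R))).
    by rewrite ler_pM2r ?divr_gt0//; nra.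
  by nra.
have dist k : `|f (k%:R / n%:R) - f y| <=
    e / 2 + 1 / (2 * e) * (k%:R / n%:R - y) ^+ 2.
  exact: le_trans (flip _ _) (abound _).
rewrite ler_distlC; apply/andP; split.
- apply: le_trans (_ : f y + (-1) * (e / 2 + y * (1 - y) / (2 * e * n%:R)) <= _).
    by rewrite mulN1r lerD2l lerN2.
  rewrite -quad; apply: le_bernstein => // k.
  by have := dist k; rewrite ler_distl => /andP[]; lra.
- apply: le_trans (_ : f y + 1 * (e / 2 + y * (1 - y) / (2 * e * n%:R)) <= _);
    last first.
    by rewrite mul1r lerD2l.
  rewrite -quad; apply: le_bernstein => // k.
  by have := dist k; rewrite ler_distl => /andP[]; lra.
Unshelve. all: by end_near. Qed.

Lemma bernstein_bounded {R : realType} (n : nat) (phi : nat -> R) (y C : R) :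
  0 <= y <= 1 -> (forall k, `|phi k| <= C) -> `|(bernstein n phi).[y]| <= C.
Proof.
move=> y01 phiC; rewrite ler_norml.
have cst c : (bernstein n (fun k => c + 0 * (k%:R - 0) ^+ 2)).[y] = c.
  by rewrite bernstein_quadratic mul0r addr0.
apply/andP; split; [rewrite -[leLHS]cst|rewrite -[leRHS]cst];
  by apply: le_bernstein => // k; have := phiC k;
    rewrite ler_norml mul0r addr0 => /andP[].
Qed.

Lemma dominated_cvg d (T : measurableType d) (R : realType)
    (mu : {measure set T -> \bar R}) (D : set T) (f_ : nat -> T -> R)
    (f g : T -> R) : measurable D ->
  (forall n, measurable_fun D (f_ n)) -> measurable_fun D f ->
  {ae mu, forall x, D x -> f_ ^~ x @ \oo --> f x} ->
  mu.-integrable D (EFin \o g) ->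
  (forall n x, D x -> `|f_ n x| <= g x) ->
  (fun n => \int[mu]_(x in D) (f_ n x)%:E)%E @ \oo -->
  (\int[mu]_(x in D) (f x)%:E)%E.
Proof.
move=> mD mf_ mf f_f ig f_g.
have [] // := @dominated_convergence _ _ _ mu D mD (fun n x => (f_ n x)%:E)
  (EFin \o f) (EFin \o g).
- by move=> n; apply/measurable_EFinP.
- exact/measurable_EFinP.
- apply: filterS f_f => x f_f Dx /=; apply: cvg_EFin; first exact: nearW.
  exact: f_f.
- by apply: aeW => x n Dx; rewrite lee_fin; exact: f_g.
Qed.

Section laplace_uniqueness.
Context {R : realType}.
Local Notation mu := (@lebesgue_measure R).
Local Notation D := (`[0, +oo[%classic : set R).

Lemma expRN01 (t : R) : 0 <= t -> 0 <= expR (- t) <= 1.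
Proof. by move=> t0; rewrite expR_ge0 -[leRHS]expR0 ler_expR oppr_le0. Qed.

Lemma lipschitz_continuous (f : R -> R) :
  (forall a b, `|f a - f b| <= `|a - b|) -> continuous f.
Proof.
move=> flip x; apply/cvgrPdist_le => e e0; near=> y.
by apply: le_trans (flip _ _) _; near: y; exact: cvgr_dist_le.
Unshelve. all: by end_near. Qed.

Lemma measurable_expRN (A : set R) : measurable_fun A (fun t : R => expR (- t)).
Proof. exact: measurableT_comp. Qed.

Lemma measurable_comp_expRN (f : R -> R) (A : set R) :
  continuous f -> measurable_fun A (fun t => f (expR (- t))).
Proof.
move=> cf; apply: (@measurableT_comp _ _ _ _ _ _ f); last exact: measurable_expRN.
exact: continuous_measurable_fun.
Qed.

Variable w : R -> R.
Hypothesis iw : mu.-integrable D (EFin \o w).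
Hypothesis w_moments : forall n : nat,
  (\int[mu]_(t in D) (w t * expR (- t) ^+ n)%:E = 0)%E.

Let mw : measurable_fun D w.
Proof. by apply/measurable_EFinP; exact: measurable_int iw. Qed.

Lemma integrable_mul_bounded (h : R -> R) (C : R) : measurable_fun D h ->
  (forall t, 0 <= t -> `|h t| <= C) ->
  mu.-integrable D (EFin \o (fun t => w t * h t)).
Proof.
move=> mh hC; rewrite (_ : _ \o _ = (EFin \o w) \* (EFin \o h))%E; last first.
  by apply/funext => t /=; rewrite EFinM.
apply: integrableMl => //; exists C; split; first exact: num_real.
move=> x Cx t /=; rewrite in_itv/= andbT => t0.
by apply: le_trans (hC _ t0) _; exact: ltW.
Qed.

(** In the variable y = e^(-t), [w_moments] says that all moments vanish, hence all polynomials are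
    annihilated. *)
Lemma integral_mul_horner (p : {poly R}) :
  (\int[mu]_(t in D) (w t * p.[expR (- t)])%:E = 0)%E.
Proof.
pose f (i : nat) (t : R) := ((p`_i)%:E * (w t * expR (- t) ^+ i)%:E)%E.
have iwn i : mu.-integrable D (fun t => (w t * expR (- t) ^+ i)%:E).
  apply: (@integrable_mul_bounded _ 1).
    by apply: measurable_funX; exact: measurable_expRN.
  move=> t t0; have /andP[e0 e1] := expRN01 t0.
  by rewrite ger0_norm ?exprn_ge0// exprn_ile1.
transitivity (\int[mu]_(t in D) (\sum_(i < size p) f i t))%E.
  apply: eq_integral => t _; rewrite horner_coef mulr_sumr -sumEFin.
  by apply: eq_bigr => i _; rewrite /f -EFinM mulrCA.
rewrite integral_sum//; last by move=> i; apply: integrableZl.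
by rewrite big1// => i _; rewrite integralZl// w_moments mule0.
Qed.

(** Bernstein polynomials of [f] converge pointwise and stay bounded by [C], so [C * |w|] dominates.
    Lipschitz test functions are enough, since tents will be used. *)
Lemma integral_mul_lipschitz (f : R -> R) (C : R) :
  (forall a b, `|f a - f b| <= `|a - b|) -> (forall a, `|f a| <= C) ->
  (\int[mu]_(t in D) (w t * f (expR (- t)))%:E = 0)%E.
Proof.
move=> flip fC.
pose h (n : nat) (t : R) := (bernstein n (fun k => f (k%:R / n%:R))).[expR (- t)].
have mp (p : {poly R}) : measurable_fun D (fun t : R => p.[expR (- t)]).
  by apply: measurable_comp_expRN; exact: continuous_horner.
have mf : measurable_fun D (fun t => f (expR (- t))).
  by apply: measurable_comp_expRN; exact: lipschitz_continuous.
have h0 : (fun n => (\int[mu]_(t in D) (w t * h n t)%:E)%E) @ \oo --> (0 : \bar R)%E.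
  rewrite (_ : (fun _ => _) = cst 0%E); first exact: cvg_cst.
  by apply/funext => n; exact: integral_mul_horner.
refine (cvg_unique (@ereal_hausdorff _) _ h0).
apply: (@dominated_cvg _ _ _ mu D (fun n t => w t * h n t)
  (fun t => w t * f (expR (- t))) (fun t => C * `|w t|)) => //.
- by move=> n; exact: (measurable_funM mw (mp _)).
- exact: (measurable_funM mw mf).
- apply: aeW => t /=; rewrite in_itv/= andbT => t0.
  by apply: cvgMr; apply: bernstein_cvg => //; exact: expRN01.
- rewrite (_ : _ \o _ = fun t => (C%:E * `|(EFin \o w) t|)%E)//.
  by apply: integrableZl => //; exact: integrable_abse.
- move=> n t /=; rewrite in_itv/= andbT => t0.
  by rewrite normrM mulrC ler_wpM2r// bernstein_bounded// expRN01.
Qed.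

(** Were w(t0) > 0, [w] would be positive just to the right of t0. Testing against a tent supported
    there gives a nonnegative integrand with zero integral, yet positive on an interval. *)
Lemma moments_right_cvg_le0 (t0 : R) : 0 <= t0 ->
  w x @[x --> t0^'+] --> w t0 -> w t0 <= 0.
Proof.
move=> t0_ge0 wt0; rewrite leNgt; apply/negP => wt0_gt0.
have [e /= e0 we] : \forall x \near t0^'+, 0 < w x.
  exact: (cvgr_gt (w t0) wt0).
have {}we t : t0 < t < t0 + e -> 0 < w t.
  move=> /andP[t0t te]; apply: we => //=.
  by rewrite ltr_distlC; apply/andP; split; lra.
(* The map t -> e^(-t) sends the interval to ]c, d[, reversing its ends; [f] is the tent of slope 1
   over [c, d]. *)
pose c := expR (- (t0 + e)); pose d := expR (- t0).
pose f (y : R) := Num.max 0 ((d - c) / 2 - `|y - (c + d) / 2|).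
have cd : c < d by rewrite ltr_expR ltrN2 ltrDl.
have f0 y : 0 <= f y by rewrite le_max lexx.
have fC y : `|f y| <= (d - c) / 2.
  rewrite ger0_norm// ge_max gerBl normr_ge0 andbT.
  by rewrite divr_ge0// subr_ge0 ltW.
have flip a b : `|f a - f b| <= `|a - b|.
  have h x y : f x <= f y + `|x - y|.
    rewrite {1}/f ge_max addr_ge0//=.
    apply: le_trans (_ : ((d - c) / 2 - `|y - (c + d) / 2|) + `|x - y| <= _).
      have := ler_distD x y ((c + d) / 2); rewrite (distrC y x).
      move: `|y - _| `|x - y| `|x - _| => p q r; lra.
    by rewrite lerD2r le_max lexx orbT.
  by rewrite ler_distl; have := h a b; have := h b a; rewrite (distrC b a); lra.
have f_gt0 t : t0 < t < t0 + e -> 0 < f (expR (- t)).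
  move=> /andP[t0t te]; rewrite lt_max; apply/orP; right.
  rewrite subr_gt0 ltr_norml.
  have : c < expR (- t) by rewrite ltr_expR ltrN2.
  have : expR (- t) < d by rewrite ltr_expR ltrN2.
  by move=> *; apply/andP; split; lra.
have f_eq0 t : ~~ (t0 < t < t0 + e) -> f (expR (- t)) = 0.
  move=> t_out; apply/max_idPl; rewrite subr_le0.
  move: t_out; rewrite negb_and -!leNgt => /orP[tt0|tt0].
    have : d <= expR (- t) by rewrite ler_expR lerN2.
    by move=> ?; rewrite ger0_norm; lra.
  have : expR (- t) <= c by rewrite ler_expR lerN2.
  by move=> ?; rewrite ler0_norm; lra.
have wf0 t : 0 <= w t * f (expR (- t)).
  have [/we/ltW w0|/f_eq0 ->] := boolP (t0 < t < t0 + e); last by rewrite mulr0.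
  exact: mulr_ge0.
have := integral_mul_lipschitz flip fC.
under eq_integral do rewrite -[w _ * _]ger0_norm//.
have mwf : measurable_fun D (fun t => (w t * f (expR (- t)))%:E).
  apply/measurable_EFinP; apply: measurable_funM => //.
  by apply: measurable_comp_expRN; exact: lipschitz_continuous.
move=> /(ae_eq_integral_abs mu (measurable_itv _) mwf)[N [mN N0 sN]].
have : (mu `]t0, (t0 + e)%R[%classic <= mu N)%E.
  rewrite le_measure ?inE// => t /=; rewrite in_itv/= => tt0.
  apply: sN => /=; apply/not_implyP; split.
    by move: tt0 => /andP[/ltW /(le_trans t0_ge0)]; rewrite in_itv/= andbT.
  by apply/eqP; rewrite eqe mulf_neq0// gt_eqF ?we ?f_gt0.
by rewrite N0 lebesgue_measure_itv/= lte_fin ltrDl e0 -EFinD lee_fin; lra.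
Qed.
End laplace_uniqueness.

Section laplace_injective.
Context {R : realType}.
Local Notation mu := (@lebesgue_measure R).
Local Notation D := (`[0, +oo[%classic : set R).
Local Notation lap F s := (fun t : R => expR (- s * t) * F t).

Lemma laplace_le (F G : R -> R) (s0 : R) :
  (forall n : nat, mu.-integrable D (EFin \o lap F (s0 + n%:R))) ->
  (forall n : nat, mu.-integrable D (EFin \o lap G (s0 + n%:R))) ->
  (forall n : nat, \int[mu]_(t in D) (lap F (s0 + n%:R) t)%:E =
                   \int[mu]_(t in D) (lap G (s0 + n%:R) t)%:E)%E ->
  forall t : R, 0 <= t -> F x @[x --> t^'+] --> F t ->
    G x @[x --> t^'+] --> G t -> F t <= G t.
Proof.
move=> iF iG FG t t0 cF cG.
(* Absorbing e^(-s0 x) into the weight turns the transforms at s0 + n into moments of order n. *)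
pose w (x : R) := expR (- s0 * x) * F x - expR (- s0 * x) * G x.
have wE (n : nat) (x : R) : w x * expR (- x) ^+ n =
    expR (- (s0 + n%:R) * x) * F x - expR (- (s0 + n%:R) * x) * G x.
  rewrite /w -expRM_natl -mulrBr -mulrBr mulrAC -expRD; congr (expR _ * _); ring.
have : w t <= 0.
  apply: moments_right_cvg_le0 => //.
  - move: (iF 0%N) (iG 0%N); rewrite addr0 => iF0 iG0.
    by refine (@eq_integrable _ _ _ mu D (measurable_itv _) _ _ _
      (@integrableB _ _ _ mu D (measurable_itv _) _ _ iF0 iG0)).
  - move=> n; under eq_integral do rewrite wE EFinB.
    rewrite (@integralB_EFin _ _ _ mu D _ _ (measurable_itv _) (iF n) (iG n)) FG
      subee//.
    by apply: integrable_fin_num (iG n); exact: measurable_itv.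
  - have ce : expR (- s0 * x) @[x --> t^'+] --> expR (- s0 * t).
      apply/cvg_at_right_filter; apply: continuous_comp; last exact: continuous_expR.
      by apply: cvgMr; exact: cvg_id.
    by apply: cvgB; apply: cvgM.
by rewrite /w -mulrBr pmulr_rle0 ?expR_gt0// subr_le0.
Qed.

Lemma laplace_injective (F G : R -> R) (s0 : R) :
  (forall n : nat, mu.-integrable D (EFin \o lap F (s0 + n%:R))) ->
  (forall n : nat, mu.-integrable D (EFin \o lap G (s0 + n%:R))) ->
  (forall n : nat, \int[mu]_(t in D) (lap F (s0 + n%:R) t)%:E =
                   \int[mu]_(t in D) (lap G (s0 + n%:R) t)%:E)%E ->
  forall t : R, 0 <= t -> F x @[x --> t^'+] --> F t ->
    G x @[x --> t^'+] --> G t -> F t = G t.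
Proof.
move=> iF iG FG t t0 cF cG; apply/eqP; rewrite eq_le.
by rewrite (laplace_le iF iG)//= (laplace_le iG iF)// => n.
Qed.
End laplace_injective.

(** * The Gamma function and the Mittag-Leffler function *)

Section gamma_laplace.
Context {R : realType}.
Local Notation mu := (@lebesgue_measure R).
Local Notation D := (`[0, +oo[%classic : set R).

Lemma continuous_powR_ge0 (a : R) : 0 <= a ->
  {within `[0, +oo[, continuous (fun u : R => u `^ a)}.
Proof.
move=> a0; apply/continuous_within_itvcyP; split.
  move=> x; rewrite in_itv/= andbT => x0.
  apply/differentiable_continuous/derivable1_diffP; apply: derivable_powR.
  by rewrite in_itv/= andbT.
have [->|a_neq0] := eqVneq a 0.
  rewrite (_ : (fun _ => _) = cst 1); first by rewrite powRr0; exact: cvg_cst.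
  by apply/funext => u; rewrite powRr0.
by rewrite powR0//; apply: powR_cvg0; rewrite lt_neqAle eq_sym a_neq0.
Qed.

Lemma measurable_powR_expRN (A : set R) (a s : R) :
  measurable_fun A (fun u : R => u `^ a * expR (- s * u)).
Proof.
apply: measurable_funM; first exact: measurable_funTS.
by apply: measurableT_comp => //; exact: measurable_funM.
Qed.

(** A single term of the exponential series at u/2 bounds u^n. The rate 1/2 leaves e^(-u/2) to
    integrate after multiplication by e^(-u), that is, a multiple of an exponential density. *)
Lemma powR_le_expR (a : R) : 0 <= a ->
  exists C : R, forall u, 0 <= u -> u `^ a <= C * expR (2^-1 * u).
Proof.
move=> a0; pose n := (Num.truncn a).+1; pose K : R := n`!%:R * 2 ^+ n.
have K0 : 0 <= K by rewrite mulr_ge0.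
exists (1 + K) => u u0.
have e1 : 1 <= expR (2^-1 * u) by rewrite -expR0 ler_expR mulr_ge0.
have [u1|/ltW u1] := leP u 1.
  apply: (@le_trans _ _ 1); last by nra.
  have [->|nu] := eqVneq u 0.
    by have [->|?] := eqVneq a 0; [rewrite powRr0|rewrite powR0].
  by have := @ge0_ler_powR _ a a0 u 1; rewrite powR1 !nnegrE; apply.
apply: le_trans (_ : u `^ n%:R <= _).
  by rewrite ler_powR// ltW// truncnS_gt.
rewrite powR_mulrn//.
have uK : u ^+ n = K * ((2^-1 * u) ^+ n / n`!%:R).
  by rewrite exprMn exprVn /K; field; rewrite pnatr_eq0 -lt0n fact_gt0 expf_neq0.
rewrite uK; have : (2^-1 * u) ^+ n / n`!%:R <= expR (2^-1 * u).
  have := @expR_ge1Dxn _ (2^-1 * u) n.-1; rewrite mulr_ge0//= => /(_ isT); lra.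
by move: (_ / _) => v; nra.
Qed.

Lemma integrable_powR_expRN (a : R) : 0 <= a ->
  mu.-integrable D (fun u => (u `^ a * expR (- u))%:E).
Proof.
move=> a0; have [C hC] := powR_le_expR a0.
have h0 : 0 < 2^-1 :> R by rewrite invr_gt0.
have iexp := integrable_exponential_pdf h0.
have {}iexp : mu.-integrable D (EFin \o exponential_pdf (2^-1 : R)).
  exact: integrableS iexp.
apply: (@le_integrable _ _ _ mu D (measurable_itv _) _
  (fun u => (2 * C)%:E * (exponential_pdf (2^-1) u)%:E)%E).
- apply/measurable_EFinP; apply: measurable_funM; last exact: measurable_expRN.
  exact: measurable_funTS.
- move=> u /=; rewrite in_itv/= andbT => u0.
  rewrite lee_fin exponential_pdfE//.
  rewrite ger0_norm ?mulr_ge0 ?powR_ge0 ?expR_ge0//.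
  apply: le_trans (ler_norm _).
  have -> : 2 * C * (2^-1 * expR (- 2^-1 * u)) = C * expR (2^-1 * u) * expR (- u).
    rewrite -[RHS]mulrA -expRD (_ : 2^-1 * u - u = - 2^-1 * u); last by field.
    by field.
  by rewrite ler_wpM2r ?expR_ge0// hC.
- by apply: integrableZl => //.
Qed.

Lemma Gamma1DE (a : R) : 0 <= a ->
  (Gamma (1 + a))%:E = (\int[mu]_(u in D) (u `^ a * expR (- u))%:E)%E.
Proof.
move=> a0; have i := integrable_powR_expRN a0.
have a1 : 1 + a - 1 = a by ring.
rewrite /Gamma /Rintegral a1 integral_itv_obnd_cbnd; last first.
  apply/measurable_EFinP; apply: measurable_funM; last exact: measurable_expRN.
  exact: measurable_funTS.
by rewrite fineK//; exact: integrable_fin_num.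
Qed.

Lemma Gamma1D_gt0 (a : R) : 0 <= a -> 0 < Gamma (1 + a).
Proof.
move=> a0; rewrite -lte_fin Gamma1DE// lt0e integral_ge0 ?andbT; last first.
  by move=> u _; rewrite lee_fin mulr_ge0 ?powR_ge0 ?expR_ge0.
apply/eqP => int0.
have mf : measurable_fun D (fun u : R => (u `^ a * expR (- u))%:E).
  apply/measurable_EFinP; apply: measurable_funM; last exact: measurable_expRN.
  exact: measurable_funTS.
have : (\int[mu]_(u in D) `|(u `^ a * expR (- u))%:E| = 0)%E.
  by rewrite -[RHS]int0; apply: eq_integral => u _;
    rewrite gee0_abs// lee_fin mulr_ge0 ?powR_ge0 ?expR_ge0.
move=> /(ae_eq_integral_abs mu (measurable_itv _) mf)[N [mN N0 sN]].
have : (mu `]0%R, 1%R[%classic <= mu N)%E.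
  rewrite le_measure ?inE// => t /=; rewrite in_itv/= => /andP[t0 t1].
  apply: sN => /=; apply/not_implyP; split; first by rewrite in_itv/= ltW.
  by apply/eqP; rewrite eqe mulf_neq0 ?gt_eqF ?powR_gt0 ?expR_gt0.
by rewrite N0 lebesgue_measure_itv/= lte_fin ltr01 sube0 lee_fin ler10.
Qed.

Lemma integral_powR_expRN (a s : R) : 0 <= a -> 0 < s ->
  (\int[mu]_(t in D) (t `^ a * expR (- s * t))%:E =
   (Gamma (1 + a) * s `^ (- (1 + a)))%:E)%E.
Proof.
move=> a0 s0.
have d1E : (fun t : R => s * t)^`()%classic = cst s.
  by apply/funext => x; rewrite derive1Ml// derive1_id mulr1.
have sub : (Gamma (1 + a))%:E =
    (\int[mu]_(t in D) (s `^ (1 + a) * (t `^ a * expR (- s * t)))%:E)%E.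
  have := @increasing_ge0_integration_by_substitutiony _ (fun t => s * t)
    (fun u => u `^ a * expR (- u)) 0.
  rewrite mulr0 d1E Gamma1DE// => ->.
  - apply: eq_integral => t; rewrite inE/= in_itv/= andbT => t0.
    rewrite /= !fctE /=; congr (_%:E);
      rewrite powRM// ?(ltW s0)// powRD ?powRr1 ?(ltW s0)//.
      by rewrite mulNr; ring.
    by rewrite (gt_eqF s0) implybT.
  - by move=> x y _ _; rewrite ltr_pM2l.
  - by move=> x _; exact: cst_continuous.
  - exact: is_cvg_cst.
  - exact: is_cvg_cst.
  - split; first by move=> x _; exact: derivableM.
    by apply/cvg_at_right_filter; apply: cvgMr; exact: cvg_id.
  - exact: gt0_cvgMry.
  - have /continuous_within_itvcyP[c1 c2] := continuous_powR_ge0 a0.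
    apply/continuous_within_itvcyP; split.
      move=> x x0; apply: cvgM; first exact: c1.
      by apply: continuous_comp; [exact: opp_continuous|exact: continuous_expR].
    apply: cvgM => //; apply/cvg_at_right_filter.
    by apply: continuous_comp; [exact: opp_continuous|exact: continuous_expR].
  - by move=> x _; rewrite mulr_ge0 ?powR_ge0 ?expR_ge0.
rewrite EFinM sub powRN muleC -ge0_integralZl//.
- apply: eq_integral => t _; rewrite -EFinM mulKf//.
  by rewrite gt_eqF// powR_gt0.
- apply/measurable_EFinP; apply: measurable_funM => //; exact: measurable_powR_expRN.
- by move=> t _; rewrite lee_fin !mulr_ge0 ?powR_ge0 ?expR_ge0.
- by rewrite lee_fin invr_ge0 powR_ge0.
Qed.
End gamma_laplace.

(** Continuity comes from differentiability; [pseries_snd_diffs] asks for convergence of the first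
    two formal derivatives. *)
Lemma continuous_pseries {R : realType} (c : nat -> R) :
  (forall z, cvgn (pseries c z)) -> continuous (fun z => limn (pseries c z)).
Proof.
move=> cc.
(* Formal differentiation keeps convergence everywhere: (n+1)|z|^n <= K^(n+1) with K = 2(|z| + 1),
   and the original series converges absolutely at K because it converges at K + 1. *)
have cd (b : nat -> R) : (forall z, cvgn (pseries b z)) ->
    forall z, cvgn (pseries (pseries_diffs b) z).
  move=> cb z; apply: normed_cvg; pose K := 2 * (`|z| + 1).
  have z0 : 0 <= `|z| by [].
  have K0 : 0 < K by rewrite /K; lra.
  have : cvgn (pseries (fun i => `|b i|) K).
    apply: (@is_cvg_pseries_inside_norm _ _ (K + 1)); first exact: cb.
    by rewrite !gtr0_norm; lra.
  set u := pseries _ K; move=> cu.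
  have cK : cvgn (series (fun i => `|b i.+1| * K ^+ i.+1)).
    apply/cvg_ex; exists (limn u - `|b 0%N|).
    rewrite (_ : series _ = (fun n => u n.+1 - `|b 0%N|)).
      by apply: cvgB; [rewrite cvg_shiftS|exact: cvg_cst].
    apply/funext => n; rewrite /u /pseries /series/= big_nat_recl//= expr0 mulr1.
    by rewrite addrAC subrr add0r.
  apply: series_le_cvg cK => n //=; first by rewrite mulr_ge0// exprn_ge0// ltW.
  rewrite /pseries_diffs normrM normrX normrM normr_nat.
  rewrite mulrAC mulrC ler_wpM2l//.
  rewrite /K exprMn; apply: ler_pM => //.
    by rewrite -natrX ler_nat ltnW// ltn_expl.
  apply: (@le_trans _ _ ((`|z| + 1) ^+ n)).
    by rewrite lerXn2r ?nnegrE ?addr_ge0// lerDl.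
  by rewrite ler_weXn2l// lerDr.
move=> z; apply/differentiable_continuous/derivable1_diffP.
have [] // := @pseries_snd_diffs _ c (`|z| + 1) z (cc _) (cd _ cc _) (cd _ (cd _ cc)
  _) _.
by have z0 := normr_ge0 z; rewrite [ltRHS]gtr0_norm; lra.
Qed.

Section mittag_leffler.
Context {R : realType} (beta : R).
Hypothesis beta_gt0 : 0 < beta.
Local Notation mu := (@lebesgue_measure R).
Local Notation D := (`[0, +oo[%classic : set R).
Let c (k : nat) : R := (Gamma (1 + beta * k%:R))^-1.

Let bk0 (k : nat) : 0 <= beta * k%:R.
Proof. by rewrite mulr_ge0// ltW. Qed.

Let c_gt0 (k : nat) : 0 < c k.
Proof. by rewrite invr_gt0 Gamma1D_gt0. Qed.

Lemma mittag_lefflerE (z : R) : mittag_leffler beta z = limn (pseries c z).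
Proof.
rewrite /mittag_leffler /pseries; congr (limn (series _)).
by apply/funext => k; rewrite mulrC.
Qed.

(* This growth of [Gamma] makes the Mittag-Leffler series dominated by a
   geometric one. *)
Lemma Gamma_ge (x a : R) : 0 < x -> 0 <= a ->
  x `^ a * expR (- (x + 1)) <= Gamma (1 + a).
Proof.
move=> x0 a0; rewrite -lee_fin Gamma1DE//.
have mf (A : set R) : measurable_fun A (fun u : R => (u `^ a * expR (- u))%:E).
  apply/measurable_EFinP; apply: measurable_funM; last exact: measurable_expRN.
  exact: measurable_funTS.
apply: (@le_trans _ _ (\int[mu]_(u in `[x, (x + 1)%R]) (u `^ a * expR (- u))%:E)%E);
  last first.
  apply: ge0_subset_integral => //=.
  - exact: mf.
  - by move=> u _; rewrite lee_fin mulr_ge0 ?powR_ge0 ?expR_ge0.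
  - by move=> u /=; rewrite !in_itv/= andbT => /andP[xu _]; rewrite (le_trans (ltW x0)).
apply: (@le_trans _ _ (\int[mu]_(u in `[x, (x + 1)%R]) (cst (x `^ a * expR (- (x +
  1)))%:E u))%E).
  rewrite (@integral_cst _ _ _ mu `[x, (x + 1)%R]%classic (measurable_itv _)).
  rewrite -[leLHS]mule1 (_ : 1%E = mu `[x, (x + 1)%R]%classic) ?lexx//.
  by rewrite lebesgue_measure_itv/= lte_fin ltrDl ltr01 -EFinB addrAC subrr add0r.
apply: ge0_le_integral => //=.
- by move=> u _; rewrite lee_fin mulr_ge0 ?powR_ge0 ?expR_ge0.
- exact: mf.
- move=> u; rewrite in_itv/= => /andP[xu ux]; rewrite lee_fin.
  rewrite ler_pM ?powR_ge0 ?expR_ge0//.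
    by apply: ge0_ler_powR => //; rewrite nnegrE; lra.
  by rewrite ler_expR lerN2.
Qed.

(** With x^beta = y the bound [Gamma_ge] reads Gamma(1 + beta k) >= y^k e^(-(x+1)), so the terms are
    dominated by a geometric series of ratio |z|/y, and y = 2(|z| + 1) makes this less than 1. *)
Lemma is_cvg_mittag_leffler (z : R) : cvgn (pseries c z).
Proof.
apply: normed_cvg.
pose y := 2 * (`|z| + 1); have z0 : 0 <= `|z| by [].
have y0 : 0 < y by rewrite /y; lra.
pose x := y `^ beta^-1.
have x0 : 0 < x by rewrite powR_gt0.
have xk (k : nat) : x `^ (beta * k%:R) = y ^+ k.
  rewrite /x -powRrM mulrA mulVf ?gt_eqF// mul1r powR_mulrn//; exact: ltW.
apply: (@series_le_cvg _ _ (geometric (expR (x + 1)) (`|z| / y))) => //=.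
- by move=> k; rewrite mulr_ge0 ?expR_ge0// exprn_ge0// divr_ge0// ltW.
- move=> k; rewrite normrM normrX gtr0_norm//.
  rewrite exprMn exprVn mulrCA mulrC ler_wpM2l ?exprn_ge0//.
  rewrite -[expR _]invrK -expRN -invfM lef_pV2 ?posrE ?Gamma1D_gt0//.
    by rewrite mulrC -xk Gamma_ge.
  by rewrite mulr_gt0 ?expR_gt0// exprn_gt0.
- apply: is_cvg_geometric_series.
  by rewrite ger0_norm ?divr_ge0 ?(ltW y0)// ltr_pdivrMr// mul1r /y; lra.
Qed.

Lemma continuous_mittag_leffler : continuous (mittag_leffler beta).
Proof.
rewrite (_ : mittag_leffler beta = (fun z => limn (pseries c z))); last first.
  by apply/funext => z; rewrite mittag_lefflerE.
exact/continuous_pseries/is_cvg_mittag_leffler.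
Qed.

(** This value excludes an atom of the waiting times at 0. *)
Lemma mittag_leffler0 : mittag_leffler beta 0 = 1.
Proof.
rewrite mittag_lefflerE.
have c0 : c 0%N = 1.
  rewrite /c mulr0; suff -> : Gamma (1 + 0 : R) = 1 by rewrite invr1.
  apply/EFin_inj; rewrite Gamma1DE//.
  rewrite -(integral_exponential_pdf (ltr01 : 0 < (1 : R))) integral_mkcond.
  apply: eq_integral => u _; rewrite /exponential_pdf !patchE.
  by case: ifP => // _; rewrite powRr0 !mul1r mulN1r.
apply/cvg_lim => //; rewrite -(cvg_shiftS (pseries c 0)).
rewrite (_ : (fun _ => _) = cst 1); first exact: cvg_cst.
apply/funext => n; rewrite /pseries /series/= big_nat_recl//= expr0 mulr1 c0.
by rewrite big1 ?addr0// => i _; rewrite expr0n mulr0.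
Qed.

Let pow_powR (a t : R) (k : nat) : 0 <= t ->
  (a * t `^ beta) ^+ k = a ^+ k * t `^ (beta * k%:R).
Proof. by move=> t0; rewrite exprMn powRrM powR_mulrn// powR_ge0. Qed.

Let inv_Gamma_powR (s : R) (k : nat) : 0 < s ->
  c k * (Gamma (1 + beta * k%:R) * s `^ (- (1 + beta * k%:R))) =
  s^-1 * (s `^ beta)^-1 ^+ k.
Proof.
move=> s0; rewrite mulKf ?gt_eqF ?Gamma1D_gt0// powRN powRD ?(gt_eqF s0) ?implybT//.
by rewrite powRr1 ?(ltW s0)// invfM powRrM powR_mulrn ?powR_ge0// exprVn.
Qed.

Let measurable_summand (A : set R) (s a : R) (n : nat) :
  measurable_fun A (fun t => expR (- s * t) * pseries c (a * t `^ beta) n).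
Proof.
apply: measurable_funM.
  by apply: measurableT_comp => //; exact: measurable_funM.
rewrite /pseries /series/=; apply: measurable_sum => k.
by apply: measurable_funM => //; apply: measurable_funX; apply: measurable_funM => //;
  exact: measurable_funTS.
Qed.

(** The Gamma factors cancel and leave a geometric series. It is used with both signs: a = lambda
    gives majorants, a = - lambda the series of interest. *)
Lemma integral_pseries (s a : R) (n : nat) : 0 < s ->
  mu.-integrable D (EFin \o (fun t => expR (- s * t) * pseries c (a * t `^ beta) n)) /\
  (\int[mu]_(t in D) (expR (- s * t) * pseries c (a * t `^ beta) n)%:E =
   (series (geometric s^-1 (a / s `^ beta)) n)%:E)%E.
Proof.
move=> s0.
pose f (k : nat) (t : R) :=
  ((a ^+ k * c k)%:E * (t `^ (beta * k%:R) * expR (- s * t))%:E)%E.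
have iterm (k : nat) : mu.-integrable D
    (fun t => (t `^ (beta * k%:R) * expR (- s * t))%:E).
  apply/integrableP; split.
    by apply/measurable_EFinP; exact: measurable_powR_expRN.
  under eq_integral do rewrite gee0_abs ?lee_fin ?mulr_ge0 ?powR_ge0 ?expR_ge0//.
  by rewrite integral_powR_expRN// ltry.
have fi (k : nat) : mu.-integrable D (f k) by exact: integrableZl.
have fE t : D t -> (expR (- s * t) * pseries c (a * t `^ beta) n)%:E =
    (\sum_(0 <= k < n) f k t)%E.
  rewrite /= in_itv/= andbT => t0; rewrite /pseries /series/= mulr_sumr -sumEFin.
  apply: eq_bigr => k _; rewrite /f -EFinM; congr (_%:E).
  by rewrite pow_powR//; ring.
split.
  refine (@eq_integrable _ _ _ mu D (measurable_itv _) (fun t => (\sum_(0 <= k < n) f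
    k t)%E) _ _ _).
    by move=> t; rewrite inE => Dt; rewrite /= fE.
  by apply: (@integrable_sum _ _ _ mu D (measurable_itv _)) => k _; exact: fi.
transitivity (\int[mu]_(t in D) (\sum_(0 <= k < n) f k t))%E.
  by apply: eq_integral => t; rewrite inE => /fE.
rewrite (@integral_sum _ _ _ mu D (measurable_itv _)); last first.
  by move=> k; exact: fi.
rewrite /series/= -sumEFin; apply: eq_bigr => k _.
rewrite (@integralZl _ _ _ mu D (measurable_itv _) _ (iterm k)).
rewrite integral_powR_expRN// -EFinM -mulrA inv_Gamma_powR// exprMn.
by congr (_%:E); ring.
Qed.

(** The alternating series is dominated by the series at +lambda, which is integrable against
    e^(-st) because the ratio lambda / s^beta is below 1. *)
Lemma laplace_mittag_leffler (s lambda : R) : 0 < s -> 0 < lambda ->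
  lambda < s `^ beta ->
  mu.-integrable D (EFin \o (fun t =>
    expR (- s * t) * mittag_leffler beta (- lambda * t `^ beta))) /\
  (\int[mu]_(t in D) (expR (- s * t) * mittag_leffler beta (- lambda * t `^ beta))%:E =
   (s^-1 / (1 + lambda / s `^ beta))%:E)%E.
Proof.
move=> s0 l0 ls.
have sb0 : 0 < s `^ beta by rewrite powR_gt0.
pose r := lambda / s `^ beta.
have r0 : 0 <= r by rewrite divr_ge0// ltW.
have r1 : r < 1 by rewrite ltr_pdivrMr// mul1r.
pose f (a : R) n t := expR (- s * t) * pseries c (a * t `^ beta) n.
have mf a n : measurable_fun D (f a n) by exact: measurable_summand.
have cf a t : f a ^~ t @ \oo --> expR (- s * t) * mittag_leffler beta (a * t `^ beta).
  by rewrite mittag_lefflerE; apply: cvgMr; exact: is_cvg_mittag_leffler.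
have mg a : measurable_fun D (fun t => expR (- s * t) * mittag_leffler beta (a * t `^
  beta)).
  by apply: (@measurable_fun_cvg _ _ _ _ (f a)) => // t _; exact: cf.
pose g t := expR (- s * t) * mittag_leffler beta (lambda * t `^ beta).
have nd t : {homo (fun n => f lambda n t) : m n / (m <= n)%N >-> m <= n}.
  apply/nondecreasing_seqP => n; rewrite ler_wpM2l ?expR_ge0//.
  rewrite /pseries /series/= big_nat_recr//= lerDl mulr_ge0 ?(ltW (c_gt0 _))//.
  by rewrite exprn_ge0// mulr_ge0 ?powR_ge0// ltW.
have fg n t : f lambda n t <= g t.
  have -> : g t = limn (f lambda ^~ t) by apply/esym/cvg_lim => //; exact: cf.
  by apply: nondecreasing_cvgn_le; [exact: nd|exact/cvgP/cf].
have f0 n t : 0 <= f lambda n t.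
  rewrite mulr_ge0 ?expR_ge0// sumr_ge0// => k _.
  by rewrite mulr_ge0 ?(ltW (c_gt0 _))// exprn_ge0// mulr_ge0 ?powR_ge0// ltW.
have g0 t : 0 <= g t by exact: le_trans (f0 0%N t) (fg _ _).
(* Monotone convergence: the integrals of the partial sums at +lambda are geometric sums, at most
   s^-1 / (1 - r). *)
have ig : mu.-integrable D (EFin \o g).
  apply/integrableP; split; first by apply/measurable_EFinP; exact: mg.
  under eq_integral do rewrite gee0_abs ?lee_fin//.
  have : (\int[mu]_(t in D) (f lambda n t)%:E)%E @[n --> \oo] --> (\int[mu]_(t in D)
    (g t)%:E)%E.
    rewrite (_ : (fun t : R => (g t)%:E) = (fun t => limn (fun n => (f lambda n
      t)%:E))); last first.
      apply/funext => t; apply/esym/cvg_lim => //; apply: cvg_EFin; first exact: nearW.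
      exact: cf.
    apply: (@cvg_monotone_convergence _ _ _ mu D (measurable_itv _)).
    - by move=> n; apply/measurable_EFinP; exact: mf.
    - by move=> n t _; rewrite lee_fin.
    - by move=> t _ m n mn; rewrite lee_fin; exact: nd.
  move=> /cvg_lim <-//.
  apply: (@le_lt_trans _ _ (s^-1 / (1 - r))%:E); last exact: ltry.
  apply: lime_le.
    apply: ereal_nondecreasing_is_cvgn => m n mn.
    apply: ge0_le_integral => //.
    - by move=> t _; rewrite lee_fin.
    - by apply/measurable_EFinP; exact: mf.
    - by apply/measurable_EFinP; exact: mf.
    - by move=> t _; rewrite lee_fin; exact: nd.
  apply: nearW => n; have [_ ->] := integral_pseries lambda n s0.
  rewrite lee_fin geometric_seriesE ?lt_eqF// ler_pdivlMr ?subr_gt0// divfK ?gt_eqF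
    ?subr_gt0//.
  by rewrite ger_pMr ?invr_gt0// gerBl exprn_ge0.
have absf n t : `|f (- lambda) n t| <= g t.
  apply: le_trans (fg n t); rewrite /f normrM ger0_norm ?expR_ge0//.
  rewrite ler_wpM2l ?expR_ge0// (le_trans (ler_norm_sum _ _ _))//.
  apply: ler_sum => k _.
  rewrite normrM (gtr0_norm (c_gt0 _)) normrX normrM normrN.
  by rewrite (gtr0_norm l0) (ger0_norm (powR_ge0 _ _)).
have lim : (fun n => \int[mu]_(t in D) (f (- lambda) n t)%:E)%E @ \oo -->
    (\int[mu]_(t in D) (expR (- s * t) * mittag_leffler beta (- lambda * t `^
      beta))%:E)%E.
  apply: (@dominated_cvg _ _ _ mu D (f (- lambda)) _ g (measurable_itv _) (mf _)
    (mg (- lambda)) _ ig) => [|n t _]; last exact: absf.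
  by apply: aeW => t _; exact: cf.
split.
  refine (@le_integrable _ _ _ mu D (measurable_itv _) _ (EFin \o g) _ _ ig).
    by apply/measurable_EFinP; exact: mg.
  move=> t _ /=; rewrite lee_fin (ger0_norm (g0 _)).
  have h : `|f (- lambda) n t| @[n --> \oo] -->
      `|expR (- s * t) * mittag_leffler beta (- lambda * t `^ beta)|.
    by apply: cvg_norm; exact: cf.
  by rewrite -(cvg_lim _ h)//; apply: limr_le; [exact: cvgP h|exact: nearW].
refine (cvg_unique (@ereal_hausdorff _) lim _).
rewrite (_ : (fun _ => _) = EFin \o series (geometric s^-1 (- r))); last first.
  by apply/funext => n /=; rewrite (integral_pseries _ _ s0).2 mulNr.
apply: cvg_EFin; first exact: nearW.
rewrite -[X in _ / (1 + X)]opprK; apply: cvg_geometric_series.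
by rewrite normrN ger0_norm.
Qed.
End mittag_leffler.

(** * Laws with Laplace transform lambda / (lambda + s ^ beta) *)

Section mittag_leffler_law.
Context {R : realType} d (T : measurableType d) (P : probability T R).
Variable X : T -> R.
Hypothesis mX : measurable_fun setT X.
Hypothesis X_ge0 : forall w, 0 <= X w.
Local Notation mu := (@lebesgue_measure R).
Local Notation D := (`[0, +oo[%classic : set R).
Let tail (t : R) : R := fine (P [set w | t < X w]).

Lemma measurable_tail_set (t : R) : measurable [set w | t < X w].
Proof.
rewrite (_ : [set _ | _] = X @^-1` `]t, +oo[%classic).
  by rewrite -[X in measurable X]setTI; exact: mX.
by apply/seteqP; split => w /=; rewrite in_itv/= andbT.
Qed.

Let tailE (t : R) : (tail t)%:E = P [set w | t < X w].
Proof. by rewrite /tail fineK// fin_num_measure//; exact: measurable_tail_set. Qed.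

Lemma tail_right_continuous (t : R) : tail x @[x --> t^'+] --> tail t.
Proof.
pose Xm : {mfun T >-> R} := HB.pack X (isMeasurableFun.Build _ _ _ _ X mX).
have E r : ccdf (P := P) Xm r = (tail r)%:E.
  by rewrite tailE /ccdf /distribution /pushforward /=; congr (P _);
    apply/seteqP; split => w /=; rewrite in_itv/= andbT.
have := @ccdf_right_continuous _ _ _ P Xm t.
by rewrite E (eq_cvg _ _ E) => /fine_cvg.
Qed.

(** Tonelli for the density s e^(-st) on the region t < X w: integrating in t first gives the
    exponential probability of [0, X w], integrating in w first gives the tail. *)
Lemma laplace_tail (s : R) : 0 < s ->
  (\int[mu]_(t in D) (s * expR (- s * t) * tail t)%:E =
   \int[P]_w (1 - expR (- s * X w))%:E)%E.
Proof.
move=> s0.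
pose f (p : T * measurableTypeR R) : \bar R :=
  (exponential_pdf s p.2 * \1_[set q : T * measurableTypeR R | q.2 < X q.1] p)%:E.
have mf : measurable_fun setT f.
  apply/measurable_EFinP; apply: measurable_funM.
    by apply: measurableT_comp;
      [exact: measurable_exponential_pdf|exact: measurable_snd].
  apply: measurable_indic.
  have := @measurable_fun_ltr _ _ _ setT (fun q : T * measurableTypeR R => q.2)
    (fun q => X q.1) _ _.
  move=> /(_ measurable_snd) /(_ (measurableT_comp mX measurable_fst)).
  by move=> /(_ measurableT [set true] I); rewrite setTI; exact.
have f0 p : (0 <= f p)%E by rewrite lee_fin mulr_ge0// exponential_pdf_ge0// ltW.
have := @fubini_tonelli _ _ _ _ _ P mu f mf f0.
have -> : (\int[P]_w \int[mu]_t f (w, t) = \int[P]_w (1 - expR (- s * X w))%:E)%E.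
  apply: eq_integral => w _.
  transitivity (\int[mu]_(t in `[0%R, X w]) (exponential_pdf s t)%:E)%E; last first.
    have [->|X0] := eqVneq (X w) 0.
      by rewrite set_itv1 integral_set1 mulr0 expR0 subrr.
    by rewrite -/(exponential_prob s _) exponential_prob_itv0c// lt_neqAle eq_sym X0
      X_ge0.
  rewrite -integral_itv_bndo_bndc; last first.
    by apply/measurable_EFinP; apply: measurable_funTS;
      exact: measurable_exponential_pdf.
  rewrite [RHS]integral_mkcond; apply: eq_integral => t _.
  rewrite /f /= [RHS]patchE indicE; have [t0|t0] := leP 0 t.
    have [tX|tX] := ltP t (X w).
      by rewrite !mem_set ?mulr1//= in_itv/= t0.
    rewrite !memNset ?mulr0//= ?in_itv/= ?t0 ?ltNge ?tX//=.
  have -> : exponential_pdf s t = 0 by exact: lt0_exponential_pdf.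
  by rewrite mul0r memNset//= in_itv/= leNgt t0//.
move=> ->; rewrite integral_mkcond; apply: eq_integral => t _.
rewrite patchE; case: ifPn => [|]; last first.
  rewrite notin_setE/= in_itv/= andbT => /negP; rewrite -ltNge => t0.
  by rewrite /f/= lt0_exponential_pdf//; under eq_integral do rewrite mul0r;
    rewrite integral0.
rewrite inE/= in_itv/= andbT => t0; rewrite EFinM tailE.
rewrite /f /= exponential_pdfE//; under eq_integral do rewrite EFinM.
rewrite ge0_integralZl//.
- congr (_ * _)%E.
  have := @integral_indic _ _ _ P setT measurableT [set w | t < X w]
    (measurable_tail_set t).
  by rewrite setIT => <-; apply: eq_integral => w _; rewrite !indicE; congr (_%:R%:E);
    apply/idP/idP; rewrite !inE.
- apply/measurable_EFinP;
    have := measurable_indic (measurable_tail_set t) (D := setT) (R := R).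
  by apply: eq_measurable_fun => w _; rewrite !indicE; congr (_%:R); apply/idP/idP;
    rewrite !inE.
- by rewrite lee_fin mulr_ge0 ?expR_ge0// ltW.
Qed.

Variables beta lambda : R.
Hypotheses (beta_gt0 : 0 < beta) (lambda_gt0 : 0 < lambda).
Hypothesis laplace_X : forall s : R, 0 < s ->
  (\int[P]_w (expR (- s * X w))%:E = (lambda / (lambda + s `^ beta))%:E)%E.

Let tail_ge0 (t : R) : 0 <= tail t.
Proof. by rewrite fine_ge0. Qed.

Let measurable_tail (s : R) :
  measurable_fun D (fun t => (expR (- s * t) * tail t)%:E).
Proof.
apply/measurable_EFinP; apply: measurable_funM.
  by apply: measurableT_comp => //; exact: measurable_funM.
apply: measurable_funTS; apply: nonincreasing_measurable => // r t rt.
rewrite fine_le ?fin_num_measure ?le_measure ?inE//; try exact: measurable_tail_set.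
by move=> w /=; exact: le_lt_trans.
Qed.

Let laplace_tail_value (s : R) : 0 < s ->
  (\int[mu]_(t in D) (expR (- s * t) * tail t)%:E =
   (s^-1 / (1 + lambda / s `^ beta))%:E)%E.
Proof.
move=> s0; have sb0 : 0 < s `^ beta by rewrite powR_gt0.
have iE : P.-integrable setT (fun w => (expR (- s * X w))%:E).
  apply/integrableP; split.
    by apply/measurable_EFinP; apply: measurableT_comp => //; exact: measurable_funM.
  under eq_integral do rewrite gee0_abs ?lee_fin ?expR_ge0//.
  by rewrite laplace_X// ltry.
have : (s%:E * \int[mu]_(t in D) (expR (- s * t) * tail t)%:E =
  1 - (lambda / (lambda + s `^ beta))%:E)%E.
  rewrite -laplace_X// -ge0_integralZl//.
  - transitivity (\int[P]_w (1 - expR (- s * X w))%:E)%E.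
      by rewrite -laplace_tail//; apply: eq_integral => t _; rewrite -EFinM mulrA.
    under eq_integral do rewrite EFinB.
    rewrite integralB_EFin//; last exact: finite_measure_integrable_cst.
    by rewrite integral_cst//= probability_setT mule1.
  - exact: measurable_tail.
  - by move=> t _; rewrite lee_fin mulr_ge0 ?expR_ge0.
  - by rewrite lee_fin ltW.
rewrite -EFinB => h.
have -> : (\int[mu]_(t in D) (expR (- s * t) * tail t)%:E =
  s^-1%:E * (s%:E * \int[mu]_(t in D) (expR (- s * t) * tail t)%:E))%E.
  by rewrite muleA -EFinM mulVf ?mul1e// gt_eqF.
rewrite h -EFinM; congr (_%:E); field.
by rewrite !gt_eqF// addr_gt0.
Qed.

Lemma tail_mittag_leffler (t : R) : 0 <= t ->
  P [set w | t < X w] = (mittag_leffler beta (- lambda * t `^ beta))%:E.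
Proof.
move=> t0; rewrite -tailE; congr (_%:E).
(* Then s0^beta = lambda + 1 > lambda, so every s0 + n lies where the Mittag-Leffler transform is
   known. *)
pose s0 := (lambda + 1) `^ beta^-1.
have s0_gt0 : 0 < s0 by rewrite powR_gt0// addr_gt0.
have sn_gt0 (n : nat) : 0 < s0 + n%:R by rewrite ltr_pwDl.
have sn (n : nat) : lambda < (s0 + n%:R) `^ beta.
  apply: (@lt_le_trans _ _ (s0 `^ beta)).
    by rewrite /s0 -powRrM mulVf ?gt_eqF// powRr1 ?ltrDl// addr_ge0// ltW.
  by apply: ge0_ler_powR; rewrite ?nnegrE ?lerDl// ltW.
apply: (@laplace_injective _ tail (fun t => mittag_leffler beta (- lambda * t `^
  beta)) s0) => //.
- move=> n; apply/integrableP; split; first exact: measurable_tail.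
  under eq_integral do rewrite gee0_abs ?lee_fin ?mulr_ge0 ?expR_ge0//.
  by rewrite laplace_tail_value ?ltry.
- by move=> n; have [] := laplace_mittag_leffler beta_gt0 (sn_gt0 n) lambda_gt0 (sn n).
- move=> n; have [_ ->] := laplace_mittag_leffler beta_gt0 (sn_gt0 n) lambda_gt0 (sn n).
  exact: laplace_tail_value.
- exact: tail_right_continuous.
- apply: continuous_cvg; first exact: continuous_mittag_leffler.
  apply: cvgMr.
  have /continuous_within_itvcyP[c1 c0] := continuous_powR_ge0 (ltW beta_gt0).
  have [->//|tn0] := eqVneq t 0.
  by apply/cvg_at_right_filter; apply: c1; rewrite in_itv/= andbT lt_neqAle eq_sym tn0.
Qed.
End mittag_leffler_law.

(** * Independence from half-lines *)

Section independence_from_rays.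
Context {R : realType} d (T : measurableType d) (P : probability T R).
Local Open Scope ereal_scope.

Lemma measurable_preimageT {d'} {S : measurableType d'} (X : T -> S) (B : set S) :
  measurable_fun setT X -> measurable B -> measurable (X @^-1` B).
Proof. by move=> mX mB; rewrite -[X in measurable X]setTI; exact: mX. Qed.

(** A pi-system generating the Borel sets; [setT] leaves a coordinate unconstrained and covers the
    line in the uniqueness theorem for measures. *)
Definition ray_system : set (set R) :=
  [set B | B = setT \/ exists a : R, B = `]a, +oo[%classic].

Lemma ray_systemI : setI_closed ray_system.
Proof.
move=> _ _ [->|[a ->]] [->|[b ->]]; rewrite ?setTI ?setIT; [by left|by right;
  exists b|by right; exists a|].
right; exists (Num.max a b); apply/seteqP; split => x /=;
  rewrite !in_itv/= !andbT gt_max.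
  by case=> -> ->.
by move=> /andP.
Qed.

Lemma measurable_ray_system : @measurable _ R = <<s ray_system >>.
Proof.
transitivity (<<s (@RGenOInfty.G R) >>); first exact: (RGenOInfty.measurableE R).
apply/seteqP; split; apply: smallest_sub; try exact: smallest_sigma_algebra.
  by move=> _ [a ->]; apply: sub_sigma_algebra; right; exists a.
move=> _ [->|[a ->]]; last by apply: sub_sigma_algebra; exists a.
by have := sigma_algebraC (@sigma_algebra0 _ setT (@RGenOInfty.G R)); rewrite setC0.
Qed.

(** Both sides are finite measures in [B], so agreement on the pi-system extends to Borel sets. Here
    [r] stands for the probabilities of the other coordinates. *)
Lemma factor_preimage (A : set T) (Y : T -> R) (r : {nonneg R}) :
  measurable A -> measurable_fun setT Y ->
  (forall B, ray_system B -> P (A `&` Y @^-1` B) = r%:num%:E * P (Y @^-1` B)) ->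
  forall B, measurable B -> P (A `&` Y @^-1` B) = r%:num%:E * P (Y @^-1` B).
Proof.
move=> mA mY h B mB.
pose m1 : {measure set R -> \bar R} := pushforward (mrestr P mA) Y.
pose m2 : {measure set R -> \bar R} := mscale r (pushforward P Y).
have E : m1 mY B = m2 mY B.
  apply: (@measure_unique _ R R ray_system (fun=> setT) measurable_ray_system
    ray_systemI _ _ (m1 mY) (m2 mY)) => //.
  - by left.
  - by rewrite bigcup_const.
  - by move=> C /h; rewrite setIC.
  - move=> _; apply: (le_lt_trans (probability_le1 P _)); last exact: ltry.
    by rewrite preimage_setT setTI.
by rewrite setIC; exact: E.
Qed.

Variable X : nat -> T -> R.
Hypothesis mX : forall i, measurable_fun setT (X i).

Let cyl (n : nat) (B : nat -> set R) := [set w | forall i, (i < n)%N -> B i (X i w)].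

Lemma measurable_cyl (n : nat) (B : nat -> set R) :
  (forall i, measurable (B i)) -> measurable (cyl n B).
Proof.
move=> mB; rewrite (_ : cyl n B = \bigcap_(i in `I_n) (X i @^-1` B i)) //.
by apply: bigcap_measurableType => i _; exact: measurable_preimageT.
Qed.

Hypothesis indep_rays : forall n (B : nat -> set R), (forall i, ray_system (B i)) ->
  P (cyl n B) = \prod_(i < n) P (X i @^-1` B i).

(** Induction on the number [m] of coordinates already freed from half-lines: the step replaces the
    half-line of coordinate [m] by a Borel set, the others being frozen. *)
Let indep_upto (m n : nat) (B : nat -> set R) : (forall i, measurable (B i)) ->
  (forall i, (m <= i)%N -> ray_system (B i)) ->
  P (cyl n B) = \prod_(i < n) P (X i @^-1` B i).
Proof.
elim: m B => [|m ih] B mB rB; first by apply: indep_rays => i; exact: rB.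
pose B' (C : set R) i := if i == m then C else B i.
have rB' C : ray_system C -> forall i, (m <= i)%N -> ray_system (B' C i).
  move=> rC i; rewrite leq_eqVlt /B' eq_sym; case: eqVneq => //= _; exact: rB.
have mB' C : measurable C -> forall i, measurable (B' C i).
  by move=> mC i; rewrite /B'; case: ifP.
have mray C : ray_system C -> measurable C.
  by move=> rC; rewrite measurable_ray_system; exact: sub_sigma_algebra.
have rT : ray_system setT by left.
have [nm|mn] := leqP n m.
  transitivity (P (cyl n (B' setT))).
    congr (P _); apply/seteqP; split => w /= h i i_n; have := h i i_n;
    by rewrite /B' ltn_eqF// (leq_trans i_n).
  rewrite ih//; [|exact: mB'|exact: rB'].
  by apply: eq_bigr => i _; rewrite /B' ltn_eqF// (leq_trans (ltn_ord i)).
pose r := \prod_(i < n | i != Ordinal mn) P (X i @^-1` B i).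
have r0 : 0 <= r by apply: prode_ge0.
have rfin : r \is a fin_num.
  by apply: prode_fin_num => i _;
    exact: fin_num_measure (measurable_preimageT (mX i) (mB i)).
pose A := cyl n (B' setT).
have cylE C : cyl n (B' C) = A `&` X m @^-1` C.
  apply/seteqP; split=> w /=.
    move=> h; split; last by have := h m mn; rewrite /B' eqxx.
    by move=> i i_n; rewrite /B'; case: eqVneq => // im; have := h i i_n;
      rewrite /B' (negbTE im).
  by move=> [h hC] i i_n; have := h i i_n; rewrite /B'; case: eqVneq => // ->.
have prodE C : \prod_(i < n) P (X i @^-1` B' C i) = r * P (X m @^-1` C).
  rewrite (bigD1 (Ordinal mn))//= muleC /B' eqxx; congr (_ * _).
  by apply: eq_bigr => i im; rewrite ifN.
have BE : B' (B m) = B by apply/funext => i; rewrite /B'; case: eqVneq => // ->.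
rewrite -BE cylE prodE -(fineK rfin).
apply: (@factor_preimage A (X m) (NngNum (fine_ge0 r0))) => //=.
  by apply: measurable_cyl; exact: mB'.
by move=> C rC; rewrite fineK// -cylE -prodE ih//; [apply: mB'; exact: mray|exact: rB'].
Qed.

Lemma mutually_independent_rays : mutually_independent P X.
Proof.
move=> s B us mB.
(* The finite family sits in an initial segment, whose other coordinates are constrained by [setT]
   only. *)
pose n := (\max_(i <- s) i).+1.
have sn i : i \in s -> (i < n)%N by move=> si; rewrite ltnS; exact: leq_bigmax_seq.
pose B' i := if i \in s then B i else setT.
have mB' i : measurable (B' i) by rewrite /B'; case: ifP.
transitivity (P (cyl n B')).
  congr (P _); apply/seteqP; split => w /= h i; last by move=> si;
    have := h i (sn i si); rewrite /B' si.
  by rewrite /B'; case: ifP => // si _; exact: h.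
rewrite (@indep_upto n); [|exact: mB'|].
  rewrite -(big_mkord xpredT (fun i => P (X i @^-1` B' i))).
  rewrite (bigID (mem s))/= [X in _ * X]big1 ?mule1; last first.
    by move=> i si; rewrite /B' (negbTE si) preimage_setT probability_setT.
  rewrite -big_filter; have -> : \prod_(i <- s) P (X i @^-1` B i) = \prod_(i <- s) P
    (X i @^-1` B' i).
    by rewrite big_seq [RHS]big_seq; apply: eq_bigr => i si; rewrite /B' si.
  apply: perm_big; apply: uniq_perm => //; first by rewrite filter_uniq// iota_uniq.
  move=> i; rewrite mem_filter/= mem_index_iota/=; case: (boolP (i \in s)) => //= /sn;
    by [].
by move=> i ni; left; rewrite /B'; case: ifPn => // /sn; rewrite ltnNge ni.
Qed.
End independence_from_rays.

(** * Sampling the two processes along a grid *)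

Section process_measurability.
Context {R : realType} d (T : measurableType d).

(** The generators of [process_sigma_algebra], named so that the sigma-algebra of a process becomes
    a measurable type: measurability lemmas instantiated there prove membership in it. *)
Definition process_generators {d'} {S : measurableType d'} (X : R -> T -> S) : set
  (set T) :=
  [set A | exists (t : R) (B : set S), [/\ 0 <= t, measurable B & A = X t @^-1` B]].

Lemma measurable_process {d'} {S : measurableType d'} (X : R -> T -> S) (t : R) :
  0 <= t ->
  measurable_fun [set: g_sigma_algebraType (process_generators X)] (X t).
Proof.
by move=> t0 _ B mB; rewrite setTI; apply: sub_sigma_algebra; exists t, B.
Qed.

End process_measurability.

(* The grid intervals [(k h, (k+1) h]] in which [N] jumps are encoded by their
   gaps: if [g i] counts the unmarked intervals between the marked ones number
   [i-1] and [i], then [block_end g i] is the index of the latter and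
   [block_start g i] is the index following the former. *)
Definition block_start (g : nat -> nat) (i : nat) : nat := \sum_(j < i) (g j).+1.
Definition block_end (g : nat -> nat) (i : nat) : nat := block_start g i + g i.
Definition mark_time (g : nat -> nat) (i : nat) : nat :=
  if i is j.+1 then block_end g j else 0%N.

Lemma block_startS g i : block_start g i.+1 = (block_end g i).+1.
Proof. by rewrite /block_start big_ord_recr /= addnS. Qed.

(** For i > 0 the extra unit is the preceding marked interval, which lies to the right of its own
    left end; the first increment starts at time 0 and has none. *)
Lemma mark_timeS g i : mark_time g i.+1 = (mark_time g i + (g i + (0 < i)))%N.
Proof.
case: i => [|i]; first by rewrite /= /block_end /block_start big_ord0 addn0.
by rewrite /= /block_end block_startS /block_end addn1 addnS addSn.
Qed.

Section marks.
Context {R : realType} d (T : measurableType d).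

Definition grid {S : Type} (X : R -> T -> S) (h : R) (k : nat) : T -> S :=
  X (k%:R * h).

(** The event that the first [n] gaps are [g]. Comparing the two ends of a block suffices for the
    absence of jumps, as the processes considered are nondecreasing. *)
Definition marks (N : R -> T -> nat) (h : R) (g : nat -> nat) (n : nat) : set T :=
  [set w | forall i, (i < n)%N ->
    grid N h (block_end g i) w = grid N h (block_start g i) w /\
    (grid N h (block_end g i) w < grid N h (block_start g i.+1) w)%N].

Definition marked_increments (D : R -> T -> R) (h : R) (g : nat -> nat)
    (B : nat -> set R) (n : nat) : set T :=
  [set w | forall i, (i < n)%N ->
    B i (grid D h (mark_time g i.+1) w - grid D h (mark_time g i) w)].

Lemma measurable_fun_set {d'} {T' : measurableType d'} (b : T' -> bool) :
  measurable_fun setT b -> measurable [set w | b w].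
Proof. by move=> /(_ measurableT [set true] I); rewrite setTI; exact. Qed.

Lemma measurable_marks (N : R -> T -> nat) (h : R) g n : 0 <= h ->
  (forall t, 0 <= t -> measurable_fun setT (N t)) -> measurable (marks N h g n).
Proof.
move=> h0 mN; have mNh (k : nat) : measurable_fun setT (grid N h k).
  by apply: mN; rewrite mulr_ge0.
rewrite (_ : marks _ _ _ _ = \bigcap_(i in `I_n)
  ([set w | grid N h (block_end g i) w == grid N h (block_start g i) w] `&`
   [set w | (grid N h (block_end g i) w < grid N h (block_start g i.+1) w)%N])).
  apply: bigcap_measurableType => i _; apply: measurableI; apply: measurable_fun_set.
    exact: measurable_fun_eqn.
  exact: measurable_fun_ltn.
by apply/seteqP; split => w /= H i /H [] /eqP.
Qed.

Lemma measurable_marked_increments (D : R -> T -> R) (h : R) g B n : 0 <= h ->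
  (forall t, 0 <= t -> measurable_fun setT (D t)) ->
  (forall i, measurable (B i)) -> measurable (marked_increments D h g B n).
Proof.
move=> h0 mD mB; have mDh (k : nat) : measurable_fun setT (grid D h k).
  by apply: mD; rewrite mulr_ge0.
rewrite (_ : marked_increments _ _ _ _ _ = \bigcap_(i in `I_n)
  ((grid D h (mark_time g i.+1) \- grid D h (mark_time g i)) @^-1` B i))//.
apply: bigcap_measurableType => i _.
by rewrite -[X in measurable X]setTI; apply: (measurable_funB (mDh _) (mDh _)).
Qed.

End marks.

Lemma big_ord_double {R : Type} {idx : R} (op : Monoid.law idx) (F : nat -> R) n :
  \big[op/idx]_(j < n.*2) F j = \big[op/idx]_(i < n) op (F i.*2) (F i.*2.+1).
Proof.
elim: n => [|n ih]; first by rewrite !big_ord0.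
by rewrite doubleS !big_ord_recr /= ih Monoid.mulmA.
Qed.

Section block_probabilities.
Context {R : realType} d (T : measurableType d) (P : probability T R).
Variables (lambda : R) (N : R -> T -> nat).
Hypotheses (lambda_gt0 : 0 < lambda) (N_poisson : poisson_process P lambda N).

Let mN (t : R) : 0 <= t -> measurable_fun setT (N t).
Proof. by case: N_poisson => + _ _ _ _; exact. Qed.

Lemma poisson_le w (s t : R) : 0 <= s -> s <= t -> (N s w <= N t w)%N.
Proof. by case: N_poisson => _ _ /(_ w)[+ _] _ _; exact. Qed.

Lemma poisson_no_increment (s t : R) : 0 <= s -> s <= t ->
  P [set w | N t w = N s w] = (expR (- lambda * (t - s)))%:E.
Proof.
move=> s0; rewrite le_eqVlt => /predU1P[<-|st].
  (* Lag 0 is treated apart, as the Poisson law is given at positive lags only. *)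
  rewrite (_ : [set _ | _] = setT) ?probability_setT ?subrr ?mulr0 ?expR0//.
  by apply/seteqP; split.
have [_ _ _ _ /(_ s t 0%N s0 st)] := N_poisson.
rewrite /poisson_pmf mulr_gt0 ?subr_gt0// expr0 fact0 invr1 !mul1r mulNr => <-.
congr (P _); apply/seteqP; split => w /=; first by move=> ->; rewrite subnn.
move=> /eqP; rewrite subn_eq0 => ts; apply/eqP; rewrite eqn_leq ts.
by rewrite poisson_le// ltW.
Qed.

Lemma poisson_increment (s t : R) : 0 <= s -> s <= t ->
  P [set w | (N s w < N t w)%N] = (1 - expR (- lambda * (t - s)))%:E.
Proof.
move=> s0 st; have t0 := le_trans s0 st.
rewrite (_ : [set _ | _] = ~` [set w | N t w = N s w]).
  rewrite probability_setC ?poisson_no_increment//.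
  rewrite (_ : [set _ | _] = [set w | N t w == N s w]).
    by apply: measurable_fun_set; apply: measurable_fun_eqn; exact: mN.
  by apply/seteqP; split => w /= /eqP.
apply/seteqP; split => w /=; first by move=> lt eq; rewrite eq ltnn in lt.
by move=> /eqP neq; rewrite ltn_neqAle eq_sym neq poisson_le.
Qed.

Lemma poisson_marks (h : R) (g : nat -> nat) (n : nat) : 0 <= h ->
  P (marks N h g n) =
  (\prod_(i < n) (expR (- lambda * h) ^+ g i * (1 - expR (- lambda * h)))%:E)%E.
Proof.
move=> h0; have [_ _ _ indep _] := N_poisson.
(* Block starts and block ends interlaced: even increments of N are the empty stretches, odd ones
   the marked intervals. *)
pose t (j : nat) : R :=
  (if odd j then block_end g j./2 else block_start g j./2)%:R * h.
have t0 : 0 <= t 0%N by rewrite mulr_ge0.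
have tS j : t j <= t j.+1.
  rewrite /t ler_wpM2r// ler_nat /= uphalf_half; case: (odd j) => /=.
    by rewrite add1n block_startS.
  by rewrite add0n /block_end leq_addr.
pose B (i : 'I_(n.*2)) : set R := if odd i then `]0, +oo[%classic else [set 0].
pose E (j : nat) : set T := if odd j then [set w | (N (t j) w < N (t j.+1) w)%N]
  else [set w | N (t j.+1) w = N (t j) w].
have BE (i : 'I_(n.*2)) : (fun w => (N (t i.+1) w)%:R - (N (t i) w)%:R) @^-1` B i = E i.
  rewrite /B /E; case: ifP => _; apply/seteqP; split => w /=.
  - by rewrite in_itv/= andbT subr_gt0 ltr_nat.
  - by rewrite in_itv/= andbT subr_gt0 ltr_nat.
  - by move=> /eqP; rewrite subr_eq0 eqr_nat => /eqP.
  - by move=> ->; rewrite subrr.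
have mB i : measurable (B i) by rewrite /B; case: ifP.
have tE j : t j.*2 = (block_start g j)%:R * h by rewrite /t odd_double doubleK.
have tO j : t j.*2.+1 = (block_end g j)%:R * h by rewrite /t /= odd_double
  uphalf_double.
have := indep n.*2 t t0 (fun i _ => tS i) (enum 'I_(n.*2)) B (enum_uniq _) mB.
rewrite big_enum/= (_ : [set _ | _] = marks N h g n); last first.
  have E0 i w : E i.*2 w = (grid N h (block_end g i) w = grid N h (block_start g i) w).
    by rewrite /E odd_double /= tO tE.
  have E1 i w : E i.*2.+1 w =
      (grid N h (block_end g i) w < grid N h (block_start g i.+1) w)%N :> Prop.
    by rewrite /E /= odd_double /= tO -doubleS tE.
  apply/seteqP; split => w /= H i.
    have HE (j : nat) (jn : (j < n.*2)%N) : E j w.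
      by rewrite -(BE (Ordinal jn)); exact: H (mem_enum _ _).
    move=> i_n; rewrite -E0 -E1; split; apply: HE; first by rewrite ltn_double.
    by rewrite -doubleS leq_double.
  move=> _; suff : E i w by rewrite -BE.
  have i_n : (i./2 < n)%N by rewrite ltn_half_double.
  have [h0' h1] := H _ i_n; rewrite -(odd_double_half i); case: (odd i).
    by rewrite add1n E1.
  by rewrite add0n E0.
move=> ->; rewrite (eq_bigr (fun i : 'I_(n.*2) => P (E i))); last by move=> i _;
  rewrite BE.
rewrite (@big_ord_double _ _ _ (fun j => P (E j))); apply: eq_bigr => i _.
rewrite /E /= odd_double /= poisson_no_increment; [|by rewrite tE mulr_ge0|exact: tS].
rewrite poisson_increment; [|by rewrite tO mulr_ge0|exact: tS].
rewrite -doubleS !tE tO block_startS -EFinM; congr (_%:E).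
rewrite /block_end -!mulrBl -natrB ?leq_addr// addKn -natrB// subSnn mul1r.
by rewrite mulrCA -expRM_natl.
Qed.
End block_probabilities.

Section marked_increments_probability.
Context {R : realType} d (T : measurableType d) (P : probability T R).
Variables (D : R -> T -> R).
Hypothesis D_levy : levy_process P D.

Let mD (t : R) : 0 <= t -> measurable_fun setT (D t).
Proof. by case: D_levy => + _ _ _ _; exact. Qed.

Lemma levy_marked_increments (h : R) (g : nat -> nat) (B : nat -> set R) (n : nat) :
  0 <= h -> (forall i, measurable (B i)) ->
  P (marked_increments D h g B n) =
  (\prod_(i < n) P (grid D h (g i + (0 < i)) @^-1` B i))%E.
Proof.
move=> h0 mB; have [_ D0 _ indep stat] := D_levy.
pose t (j : nat) : R := (mark_time g j)%:R * h.
have t0 : 0 <= t 0%N by rewrite mulr_ge0.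
have tS j : t j <= t j.+1 by rewrite /t ler_wpM2r// ler_nat mark_timeS leq_addr.
have := indep n t t0 (fun i _ => tS i) (enum 'I_n) (fun i => B i) (enum_uniq _)
  (fun i => mB i).
rewrite big_enum/= (_ : [set _ | _] = marked_increments D h g B n); last first.
  apply/seteqP; split => w /= H i.
    by move=> i_n; exact: (H (Ordinal i_n) (mem_enum _ _)).
  by move=> _; exact: H.
move=> ->; apply: eq_bigr => i _.
have := stat (t i) ((g i + (0 < i))%:R * h) (B i); rewrite !mulr_ge0//.
move=> /(_ isT isT (mB i)).
rewrite -mulrDl -natrD -mark_timeS => ->; congr (P _).
by apply/seteqP; split => w /=; rewrite D0 subr0.
Qed.

Variables (lambda : R) (N : R -> T -> nat).
Hypotheses (lambda_gt0 : 0 < lambda) (N_poisson : poisson_process P lambda N).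
Hypothesis N_D_indep : independent_processes P N D.

Definition geometric_pmf (h : R) (a : nat) : R :=
  expR (- lambda * h) ^+ a * (1 - expR (- lambda * h)).

(** With [g] fixed, D is sampled at deterministic times, so the two events lie in the sigma-algebras
    of the two processes. *)
Lemma marks_marked_increments (h : R) (g : nat -> nat) (B : nat -> set R) (n : nat) :
  0 <= h -> (forall i, measurable (B i)) ->
  P (marks N h g n `&` marked_increments D h g B n) =
  (\prod_(i < n) ((geometric_pmf h (g i))%:E *
                  P (grid D h (g i + (0 < i)) @^-1` B i)))%E.
Proof.
move=> h0 mB; rewrite N_D_indep.
- by rewrite (poisson_marks lambda_gt0 N_poisson)// levy_marked_increments// big_split.
- exact: (@measurable_marks _ _ (g_sigma_algebraType (process_generators N)) N h g n h0
    (@measurable_process _ _ _ _ _ N)).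
- exact: (@measurable_marked_increments _ _ (g_sigma_algebraType (process_generators D))
    D h g B n h0 (@measurable_process _ _ _ _ _ D) mB).
Qed.

End marked_increments_probability.

(** * Random gaps between the marked intervals *)

Section random_marks.
Context {R : realType} d (T : measurableType d).
Variables (N : R -> T -> nat) (h : R).

Definition first_gap_set (m : nat) (w : T) : set nat :=
  [set j | grid N h (m + j) w = grid N h m w /\
           (grid N h (m + j) w < grid N h (m + j).+1 w)%N].

(* [xget] returns the default value 0 when [N] has no jump after [m * h]. *)
Definition gap (m : nat) (w : T) : nat := xget 0%N (first_gap_set m w).

Fixpoint start (i : nat) (w : T) : nat :=
  if i is j.+1 then (start j w + gap (start j w) w).+1 else 0%N.

Definition random_gap (i : nat) (w : T) : nat := gap (start i w) w.

Definition unbounded (w : T) := forall m : nat, exists j : nat, (m < grid N h j w)%N.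

Hypothesis N_le : forall w (i j : nat), (i <= j)%N -> (grid N h i w <= grid N h j w)%N.

Lemma first_gap_unique m w j k : first_gap_set m w j -> first_gap_set m w k -> j = k.
Proof.
wlog jk : j k / (j < k)%N => [wlg|].
  by have [jk|kj|//] := ltngtP j k => gj gk; [exact: wlg|apply/esym/wlg].
move=> [gj ltj] [gk _]; move: ltj; rewrite gj -gk ltnNge N_le// -addnS leq_add2l //.
Qed.

Lemma first_gap_exists m w : unbounded w -> exists j, first_gap_set m w j.
Proof.
move=> /(_ (grid N h m w))[j0 lt0].
have ex : exists j, (grid N h m w < grid N h (m + j) w)%N.
  by exists j0; apply: leq_trans lt0 _; apply: N_le; rewrite leq_addl.
(* The least shift at which N has increased is positive; its predecessor is the gap. *)
have := ex_minnP ex; case: (ex_minnP ex) => [[|j] mj minj] _.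
  by rewrite addn0 ltnn in mj.
exists j; have gj : grid N h (m + j) w = grid N h m w.
  apply/eqP; rewrite eqn_leq; apply/andP; split; last by rewrite N_le// leq_addr.
  by rewrite leqNgt; apply/negP => /minj; rewrite ltnn.
by split => //; rewrite gj -addnS.
Qed.

Lemma gapP m w : unbounded w -> first_gap_set m w (gap m w).
Proof. by move=> /(first_gap_exists m)[j hj]; rewrite /gap;
  case: xgetP => // /(_ j). Qed.

Lemma gap_eq m w j : first_gap_set m w j -> gap m w = j.
Proof. by move=> hj; apply: xget_unique => // k hk; exact: first_gap_unique hk hj. Qed.

(** Turns recursively defined random gaps into an event at fixed grid times. Unboundedness rules out
    the default gap 0, which would not witness a jump. *)
Lemma random_gapP (g : nat -> nat) (n : nat) (w : T) : unbounded w ->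
  (forall i, (i < n)%N -> random_gap i w = g i) <-> marks N h g n w.
Proof.
move=> uw.
have startE m : (forall i, (i < m)%N -> random_gap i w = g i) -> start m w =
  block_start g m.
  elim: m => [|m ih] H; first by rewrite /block_start big_ord0.
  rewrite block_startS /= -/(random_gap m w) H// ih// => i im.
  by apply: H; rewrite ltnW.
split => [H i i_n|H].
  have [] := gapP (start i w) uw; rewrite -/(random_gap i w) H// startE ?block_startS//.
  by move=> j ji; apply: H; exact: ltn_trans i_n.
elim: n H => // n ih H.
have {}ih : forall i, (i < n)%N -> random_gap i w = g i.
  by apply: ih => i i_n; apply: H; exact: ltnW.
move=> i; rewrite ltnS leq_eqVlt => /predU1P[->|]; last exact: ih.
rewrite /random_gap startE//; apply: gap_eq.
by have [] := H n (ltnSn _); rewrite block_startS.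
Qed.

End random_marks.

Section ae_lemmas.
Context {R : realType} d (T : measurableType d) (P : probability T R).

Lemma cvg_probability (A_ : nat -> set T) (A : set T) :
  (forall n, measurable (A_ n)) -> measurable A ->
  {ae P, forall w, \forall n \near \oo, A_ n w <-> A w} ->
  (P \o A_) n @[n --> \oo] --> P A.
Proof.
move=> mA_ mA aeA.
have := @dominated_cvg _ _ _ P setT (fun n => \1_(A_ n)) (\1_A) (cst 1) measurableT
  (fun n => measurable_indic (mA_ n)) (measurable_indic mA).
have -> : (fun n => (\int[P]_(x in setT) (\1_(A_ n) x)%:E)%E) = P \o A_.
  by apply/funext => n; rewrite integral_indic// setIT.
rewrite integral_indic// setIT; apply.
- apply: filterS aeA => w aeA _; apply: cvg_near_cst.
  by apply: filterS aeA => n [AnA AAn]; rewrite !indicE; congr (_%:R);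
    congr nat_of_bool; apply/idP/idP; rewrite !inE.
- exact: finite_measure_integrable_cst.
- by move=> n w _; rewrite indicE ger0_norm// lern1 leq_b1.
Qed.

Lemma eq_probability_ae (A B : set T) : measurable A -> measurable B ->
  {ae P, forall w, A w <-> B w} -> P A = P B.
Proof.
move=> mA mB AB.
have : (P \o (fun=> A)) n @[n --> \oo] --> P B.
  by apply: cvg_probability => //; apply: filterS AB => w AB; exact: nearW.
by apply: cvg_unique; [exact: ereal_hausdorff|exact: cvg_cst].
Qed.

Lemma measurable_to_nat (K : T -> nat) :
  (forall j, measurable [set w | K w = j]) -> measurable_fun setT K.
Proof.
move=> mK _ B _; rewrite setTI.
rewrite (_ : K @^-1` B = \bigcup_(j in B) [set w | K w = j]).
  by apply: bigcup_measurable => j _; exact: mK.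
by apply/seteqP; split => w /=; [exists (K w)|case=> j Bj ->].
Qed.

Lemma measurable_fun_nat_comp d' (S : measurableType d') (F : nat -> T -> S) (K : T
  -> nat) :
  (forall k, measurable_fun setT (F k)) -> measurable_fun setT K ->
  measurable_fun setT (fun w => F (K w) w).
Proof.
move=> mF mK _ B mB; rewrite setTI.
rewrite (_ : _ @^-1` B = \bigcup_k (K @^-1` [set k] `&` F k @^-1` B)).
  by apply: bigcup_measurable => k _; apply: measurableI; exact: measurable_preimageT.
by apply/seteqP; split => w /=; [exists (K w)|case=> k _ [/= ->]].
Qed.

End ae_lemmas.

Lemma eq_mark_time (g g' : nat -> nat) (i : nat) :
  (forall j, (j < i)%N -> g j = g' j) -> mark_time g i = mark_time g' i.
Proof.
case: i => [//|i] gg'; rewrite /= /block_end /block_start gg'//; congr addn.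
by apply: eq_bigr => j _; rewrite gg'// ltnW// ltnS.
Qed.

Lemma measurable_set_cst d (T : measurableType d) (Q : Prop) :
  measurable [set _ : T | Q].
Proof.
have [q|q] := pselect Q.
  by rewrite (_ : [set _ | _] = setT)//; apply/seteqP; split.
by rewrite (_ : [set _ | _] = set0)//; apply/seteqP; split => // w /q.
Qed.

Section spacings.
Context {R : realType} d (T : measurableType d).
Variables (N : R -> T -> nat) (D : R -> T -> R) (h : R).
Hypothesis mN : forall k, measurable_fun setT (grid N h k).
Hypothesis mD : forall k, measurable_fun setT (grid D h k).

Definition random_mark (i : nat) (w : T) : nat :=
  mark_time (random_gap N h ^~ w) i.

Definition spacing (i : nat) (w : T) : R :=
  grid D h (random_mark i.+1 w) w - grid D h (random_mark i w) w.

Lemma startE i w : start N h i w = block_start (random_gap N h ^~ w) i.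
Proof.
by elim: i => [|i ih];
  [rewrite /block_start big_ord0|rewrite block_startS /block_end -ih].
Qed.

Lemma measurable_first_gap_set m j : measurable [set w | first_gap_set N h m w j].
Proof.
rewrite (_ : [set _ | _] = [set w | grid N h (m + j) w == grid N h m w] `&`
  [set w | (grid N h (m + j) w < grid N h (m + j).+1 w)%N]).
  apply: measurableI; apply: measurable_fun_set; first exact: measurable_fun_eqn.
  exact: measurable_fun_ltn.
by apply/seteqP; split => w /= -[/eqP].
Qed.

Hypothesis N_le : forall w (i j : nat), (i <= j)%N -> (grid N h i w <= grid N h j w)%N.

Lemma measurable_gap m : measurable_fun setT (gap N h m).
Proof.
apply: measurable_to_nat => j.
(* The second set collects the paths without a later jump, where the gap takes its default value
   0. *)
rewrite (_ : [set _ | _] = [set w | first_gap_set N h m w j] `|`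
  ((\bigcap_k ~` [set w | first_gap_set N h m w k]) `&` [set _ | j = 0%N])).
  apply: measurableU; first exact: measurable_first_gap_set.
  apply: measurableI; last exact: measurable_set_cst.
  by apply: bigcap_measurableType => k _; apply: measurableC;
    exact: measurable_first_gap_set.
apply/seteqP; split => w /=.
  rewrite /gap; case: xgetP => [k -> gk <-|none <-]; [by left|right;
    split => // k _ /=].
  exact: none.
move=> [/(gap_eq N_le)//|[none ->]]; rewrite /gap; case: xgetP => // k _ gk.
by have := none k I.
Qed.

Lemma measurable_start i : measurable_fun setT (start N h i).
Proof.
elim: i => [|i ih]; first exact: measurable_cst.
apply: (@measurable_fun_nat_comp _ _ _ _ (fun m w => (m + gap N h m w).+1)) => // m.
apply: measurable_to_nat => j.
rewrite (_ : [set _ | _] = gap N h m @^-1` [set k | (m + k).+1 = j])//.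
exact: measurable_preimageT (measurable_gap m) _.
Qed.

Lemma measurable_random_gap i : measurable_fun setT (random_gap N h i).
Proof. exact: measurable_fun_nat_comp measurable_gap (measurable_start i). Qed.

Lemma measurable_random_mark i : measurable_fun setT (random_mark i).
Proof.
case: i => [|i]; first exact: measurable_cst.
rewrite /random_mark /= /block_end.
under eq_fun do rewrite -startE.
by apply: measurable_fun_addn; [exact: measurable_start|exact: measurable_random_gap].
Qed.

Lemma measurable_spacing i : measurable_fun setT (spacing i).
Proof.
by apply: measurable_funB; apply: measurable_fun_nat_comp => //;
  exact: measurable_random_mark.
Qed.

End spacings.

Lemma nneseries_geometric {R : realType} (c z : R) : 0 <= z -> z < 1 ->
  (\sum_(a <oo) (c * z ^+ a)%:E = (c / (1 - z))%:E)%E.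
Proof.
move=> z0 z1; apply/cvg_lim => //.
rewrite (_ : (fun _ => _) = EFin \o series (geometric c z)); last first.
  by apply/funext => n /=; rewrite /series/= sumEFin.
apply: cvg_EFin; first exact: nearW.
by apply: cvg_geometric_series; rewrite ger0_norm.
Qed.

(** * Joint law of the spacings at a fixed mesh *)

Section spacings_law.
Context {R : realType} d (T : measurableType d) (P : probability T R).
Variables (lambda : R) (N : R -> T -> nat) (D : R -> T -> R) (h : R).
Hypotheses (lambda_gt0 : 0 < lambda) (N_poisson : poisson_process P lambda N).
Hypothesis D_levy : levy_process P D.
Hypothesis N_D_indep : independent_processes P N D.
Hypothesis h_gt0 : 0 < h.
Hypothesis unboundedP : {ae P, forall w, unbounded N h w}.
Local Open Scope ereal_scope.

Let h0 : (0 <= h)%R := ltW h_gt0.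
Local Notation q := (geometric_pmf lambda h).

Let mN k : measurable_fun setT (grid N h k).
Proof. by case: N_poisson => + _ _ _ _; apply; rewrite mulr_ge0. Qed.

Let mD k : measurable_fun setT (grid D h k).
Proof. by case: D_levy => + _ _ _ _; apply; rewrite mulr_ge0. Qed.

Lemma grid_poisson_le w (i j : nat) : (i <= j)%N -> (grid N h i w <= grid N h j w)%N.
Proof.
by move=> ij; apply: (poisson_le N_poisson); rewrite ?mulr_ge0// ler_wpM2r// ler_nat.
Qed.

Lemma expR_rate_lt1 : (expR (- lambda * h) < 1)%R.
Proof. by rewrite -expR0 ltr_expR mulNr oppr_lt0 mulr_gt0. Qed.

Lemma geometric_pmf_ge0 a : (0 <= q a)%R.
Proof. by rewrite mulr_ge0 ?exprn_ge0 ?expR_ge0// subr_ge0 ltW// expR_rate_lt1. Qed.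

(** The mixture obtained by conditioning on gap number [i], which has a geometric law. *)
Definition spacing_law (i : nat) (B : set R) : \bar R :=
  \sum_(a <oo) ((q a)%:E * P (grid D h (a + (0 < i)) @^-1` B)).

Let mpre k B : measurable B -> measurable (grid D h k @^-1` B).
Proof. exact: measurable_preimageT. Qed.

Lemma spacing_law_fin_num i B : measurable B -> spacing_law i B \is a fin_num.
Proof.
move=> mB; have t0 a : 0 <= (q a)%:E * P (grid D h (a + (0 < i)) @^-1` B).
  by rewrite mule_ge0// lee_fin geometric_pmf_ge0.
rewrite ge0_fin_numE; last by apply: nneseries_ge0 => a _ _.
apply: (@le_lt_trans _ _ (\sum_(a <oo) (q a)%:E)).
  apply: lee_nneseries => [a _ _|a _]; first exact: t0.
  by rewrite -[leRHS]mule1 lee_wpmul2l ?lee_fin ?geometric_pmf_ge0//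
    probability_le1//; exact: mpre.
under eq_eseriesr do rewrite /geometric_pmf mulrC.
by rewrite nneseries_geometric ?expR_ge0 ?expR_rate_lt1// ltry.
Qed.

Lemma spacing_law_setT i : spacing_law i setT = 1.
Proof.
rewrite /spacing_law; under eq_eseriesr do
  rewrite preimage_setT probability_setT mule1 /geometric_pmf mulrC.
rewrite nneseries_geometric ?expR_ge0 ?expR_rate_lt1// divff// gt_eqF//.
by rewrite subr_gt0 expR_rate_lt1.
Qed.

(** All [n] spacings are constrained but only [m] gaps: m = n reduces to fixed grid times, m = 0 is
    the joint law sought. *)
Let prefix (n m : nat) (B : nat -> set R) (g : nat -> nat) : set T :=
  [set w | (forall i, (i < n)%N -> B i (spacing N D h i w)) /\
           (forall i, (i < m)%N -> random_gap N h i w = g i)].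

Let measurable_prefix n m B g : (forall i, measurable (B i)) ->
  measurable (prefix n m B g).
Proof.
move=> mB; rewrite (_ : prefix _ _ _ _ =
  (\bigcap_(i in `I_n) (spacing N D h i @^-1` B i)) `&`
  (\bigcap_(i in `I_m) (random_gap N h i @^-1` [set g i]))); last first.
  by apply/seteqP; split.
apply: measurableI; apply: bigcap_measurableType => i _;
  apply: measurable_preimageT => //.
  by apply: measurable_spacing => //; exact: grid_poisson_le.
by apply: measurable_random_gap => //; exact: grid_poisson_le.
Qed.

Let prefix_full n B g : (forall i, measurable (B i)) ->
  P (prefix n n B g) =
  \prod_(i < n) ((q (g i))%:E * P (grid D h (g i + (0 < i)) @^-1` B i)).
Proof.
move=> mB; rewrite -(marks_marked_increments D_levy lambda_gt0 N_poisson N_D_indep)//.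
apply: eq_probability_ae; first exact: measurable_prefix.
  have [mN' _ _ _ _] := N_poisson; have [mD' _ _ _ _] := D_levy.
  by apply: measurableI; [exact: measurable_marks|exact: measurable_marked_increments].
apply: filterS unboundedP => w uw.
have incE : (forall i, (i < n)%N -> random_gap N h i w = g i) ->
    forall i, (i < n)%N -> spacing N D h i w =
      (grid D h (mark_time g i.+1) w - grid D h (mark_time g i) w)%R.
  move=> gE i i_n; rewrite /spacing /random_mark.
  by rewrite !(@eq_mark_time _ g)// => j ji; apply: gE; apply: leq_trans ji _ => //;
    exact: ltnW.
have gP := random_gapP grid_poisson_le g n uw.
split=> [[Bw gw]|[/gP gw Bw]].
  by split; [exact/gP|move=> i i_n; rewrite -incE//; exact: Bw].
by split => // i i_n; rewrite incE//; exact: Bw.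
Qed.

(* Backward induction: the last prescribed gap is summed out by
   sigma-additivity. *)
Let prefix_probability n B : (forall i, measurable (B i)) ->
  forall k m g, (m + k)%N = n ->
  P (prefix n m B g) =
  (\prod_(i < m) ((q (g i))%:E * P (grid D h (g i + (0 < i)) @^-1` B i))) *
  \prod_(m <= i < n) spacing_law i (B i).
Proof.
move=> mB; elim=> [|k ih] m g.
  by rewrite addn0 => <-; rewrite prefix_full// big_geq// mule1.
move=> mkn; have mn : (m < n)%N by rewrite -mkn -addSnnS leq_addr.
pose upd a := fun i => if i == m then a else g i.
have -> : prefix n m B g = \bigcup_a prefix n m.+1 B (upd a).
  apply/seteqP; split => w /=.
    move=> [Bw gw]; exists (random_gap N h m w) => //; split => // i.
    by rewrite ltnS leq_eqVlt /upd; case: eqVneq => [-> //|_ /= /gw].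
  move=> [a _ [Bw gw]]; split => // i im.
  by rewrite gw /upd ?ltn_eqF//; exact: leqW.
rewrite measure_semi_bigcup; last 3 first.
- by move=> a; exact: measurable_prefix.
- apply/trivIsetP => a b _ _ ab; apply/seteqP; split => // w [[_ ga] [_ gb]].
  have := ga m (ltnSn _); rewrite gb// /upd eqxx => ba.
  by rewrite ba eqxx in ab.
- by apply: bigcup_measurable => a _; exact: measurable_prefix.
set c := \prod_(i < m) _.
have cE a : \prod_(i < m) ((q (upd a i))%:E * P (grid D h (upd a i + (0 < i)) @^-1` B
  i)) = c.
  by apply: eq_bigr => i _; rewrite /upd ltn_eqF.
have term_fin a i : (q a)%:E * P (grid D h (a + (0 < i)) @^-1` B i) \is a fin_num.
  by rewrite fin_numM// fin_num_measure//; exact: mpre.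
have cfin : c \is a fin_num by apply: prode_fin_num => i _; exact: term_fin.
set r := \prod_(m.+1 <= i < n) spacing_law i (B i).
have rfin : r \is a fin_num.
  by apply: prode_fin_num => i _; exact: spacing_law_fin_num.
(* Only the factor of index [m] depends on [a]; the finite constant c r leaves the series, and the
   sum over [a] is the law of spacing [m]. *)
rewrite (eq_eseriesr (g := fun a => (fine (c * r))%:E *
    ((q a)%:E * P (grid D h (a + (0 < m)) @^-1` B m)))); last first.
  move=> a _; transitivity (P (prefix n m.+1 B (upd a))); first by [].
  rewrite (ih m.+1); last by rewrite -mkn addSnnS.
  by rewrite big_ord_recr /= cE {1 2}/upd eqxx fineK ?fin_numM// muleAC.
rewrite nneseriesZl => [|a _]; last by rewrite mule_ge0// lee_fin geometric_pmf_ge0.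
by rewrite fineK ?fin_numM// -/(spacing_law m (B m)) [in RHS]big_ltn// -/r -muleA [r
  * _]muleC.
Qed.

Lemma spacings_probability n B : (forall i, measurable (B i)) ->
  P [set w | forall i, (i < n)%N -> B i (spacing N D h i w)] =
  \prod_(i < n) spacing_law i (B i).
Proof.
move=> mB; have := prefix_probability mB (fun=> 0%N) (add0n n).
rewrite big_ord0 mul1e big_mkord => <-; congr (P _).
by apply/seteqP; split => w /=; [move=> ?; split|case].
Qed.

Lemma spacing_probability i B : measurable B ->
  P (spacing N D h i @^-1` B) = spacing_law i B.
Proof.
move=> mB; pose C j := if j == i then B else setT.
have mC j : measurable (C j) by rewrite /C; case: ifP.
transitivity (P [set w | forall j, (j < i.+1)%N -> C j (spacing N D h j w)]).
  congr (P _); apply/seteqP; split => w /=; last by move=> /(_ i (ltnSn _));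
    rewrite /C eqxx.
  by move=> Bw j _; rewrite /C; case: eqVneq => // ->.
rewrite spacings_probability// big_ord_recr/= /C eqxx big1 ?mul1e// => j _.
by rewrite ltn_eqF// spacing_law_setT.
Qed.

End spacings_law.

Section laplace_spacing.
Context {R : realType} d (T : measurableType d) (P : probability T R).
Variables (lambda beta : R) (N : R -> T -> nat) (D : R -> T -> R) (h : R).
Hypotheses (lambda_gt0 : 0 < lambda) (N_poisson : poisson_process P lambda N).
Hypothesis D_stable : stable_subordinator P beta D.
Hypothesis N_D_indep : independent_processes P N D.
Hypothesis h_gt0 : 0 < h.
Hypothesis unboundedP : {ae P, forall w, unbounded N h w}.

Let D_levy : levy_process P D.
Proof. by case: D_stable. Qed.

Let h0 : 0 <= h := ltW h_gt0.
Local Notation q := (geometric_pmf lambda h).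

Let mN k : measurable_fun setT (grid N h k).
Proof. by case: N_poisson => + _ _ _ _; apply; rewrite mulr_ge0. Qed.

Let mD k : measurable_fun setT (grid D h k).
Proof. by case: D_levy => + _ _ _ _; apply; rewrite mulr_ge0. Qed.

(** The law is a countable sum of scaled laws of D. The weights e^(-lambda h a) and the transforms
    e^(-a h s^beta) merge into a geometric series. *)
Lemma laplace_spacing (i : nat) (s : R) : 0 <= s ->
  (\int[P]_w (expR (- s * spacing N D h i w))%:E =
   ((1 - expR (- lambda * h)) * expR (- ((0 < i)%N%:R * h * s `^ beta)) /
    (1 - expR (- (lambda + s `^ beta) * h)))%:E)%E.
Proof.
move=> s0; pose f (x : R) := (expR (- s * x))%:E.
have mf : measurable_fun setT f.
  by apply/measurable_EFinP; apply: measurableT_comp => //; exact: measurable_funM.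
have f0 x : (0 <= f x)%E by rewrite lee_fin expR_ge0.
have mX : measurable_fun setT (spacing N D h i).
  by apply: measurable_spacing => //; exact: grid_poisson_le N_poisson h_gt0.
pose mu_ (a : nat) : {measure set R -> \bar R} :=
  mscale (NngNum (geometric_pmf_ge0 lambda_gt0 h_gt0 a))
    (pushforward P (grid D h (a + (0 < i)))).
have step : (\int[P]_w f (spacing N D h i w) =
    \sum_(a <oo) (q a)%:E * \int[P]_w f (grid D h (a + (0 < i)) w))%E.
  transitivity (\int[pushforward P (spacing N D h i)]_x f x)%E.
    by rewrite ge0_integral_pushforward// preimage_setT.
  transitivity (\int[mseries (mu_ (fun a => mD _)) 0]_x f x)%E.
    apply: eq_measure_integral => B mB _.
    exact: (spacing_probability lambda_gt0 N_poisson D_levy N_D_indep h_gt0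
      unboundedP i mB).
  rewrite ge0_integral_measure_series//; apply: eq_eseriesr => a _.
  rewrite ge0_integral_mscale//; congr (_ * _)%E.
  by rewrite ge0_integral_pushforward// preimage_setT.
rewrite step.
rewrite (eq_eseriesr (g := fun a => ((1 - expR (- lambda * h)) *
   expR (- ((0 < i)%N%:R * h * s `^ beta)) * (expR (- (lambda + s `^ beta) * h)) ^+
     a)%:E)).
  rewrite nneseries_geometric ?expR_ge0// -expR0 ltr_expR mulNr oppr_lt0.
  by rewrite mulr_gt0// ltr_pwDl// powR_ge0.
move=> a _; have [_ _ lapD] := D_stable.
have := lapD s ((a + (0 < i))%:R * h) s0; rewrite mulr_ge0// => /(_ isT).
rewrite unlock /f /grid => ->; rewrite -EFinM; congr (_%:E).
rewrite /geometric_pmf -!expRM_natl.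
set ha := _ * h; have E : expR (a%:R * (- lambda * h)) * expR (- ha * s `^ beta) =
    expR (- ((0 < i)%N%:R * h * s `^ beta)) * expR (a%:R * (- (lambda + s `^ beta) *
      h)).
  by rewrite -!expRD /ha natrD; congr expR; ring.
by rewrite mulrAC E [LHS]mulrC [LHS]mulrA.
Qed.
End laplace_spacing.

(** Dividing numerator and denominator by h leaves quotients (1 - e^(-ch))/h, squeezed between c/(1
    + ch) and c by e^x >= 1 + x at x = ch and x = -ch. *)
Lemma cvg_laplace_ratio {R : realType} (u v e : R) (h : nat -> R) : 0 < u -> 0 <= v ->
  (forall n, 0 < h n) -> h @ \oo --> 0 ->
  ((1 - expR (- u * h n)) * expR (- (e * h n * v)) / (1 - expR (- (u + v) * h n)))
    @[n --> \oo] --> u / (u + v).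
Proof.
move=> u0 v0 h0 hc.
have key c : 0 < c -> ((1 - expR (- c * h n)) / h n) @[n --> \oo] --> c.
  move=> c0; apply: (@squeeze_cvgr _ _ _ _ (fun n => c / (1 + c * h n)) (fun=> c)).
  - apply: nearW => n; have hn := h0 n.
    have ch : 0 < c * h n by rewrite mulr_gt0.
    have e1 : 1 - c * h n <= expR (- c * h n).
      by rewrite mulNr; have := expR_ge1Dx (- (c * h n)); lra.
    have e2 : expR (- c * h n) <= (1 + c * h n)^-1.
      rewrite mulNr expRN lef_pV2 ?posrE ?expR_gt0//; last by lra.
      exact: expR_ge1Dx.
    apply/andP; split; last by rewrite ler_pdivrMr//; lra.
    rewrite ler_pdivlMr// (_ : c / (1 + c * h n) * h n = 1 - (1 + c * h n)^-1);
      last first.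
      by field; rewrite gt_eqF//; lra.
    by rewrite lerD2l lerN2.
  - rewrite -[X in _ --> X]divr1; apply: cvgM; first exact: cvg_cst.
    apply: cvgV => //; rewrite -[X in _ --> X]addr0; apply: cvgD; first exact: cvg_cst.
    by rewrite -(mulr0 c); apply: cvgM => //; exact: cvg_cst.
  - exact: cvg_cst.
have uv : 0 < u + v by rewrite ltr_pwDl.
rewrite (_ : (fun n => _) = (fun n => ((1 - expR (- u * h n)) / h n) *
    expR (- (e * h n * v)) / ((1 - expR (- (u + v) * h n)) / h n))); last first.
  apply/funext => n; field; rewrite gt_eqF//= subr_eq0.
  by rewrite eq_sym lt_eqF// -expR0 ltr_expR mulNr oppr_lt0 mulr_gt0.
apply: cvgM; last by apply: cvgV; [rewrite gt_eqF|exact: key].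
rewrite -[X in _ --> X]mulr1; apply: cvgM; first exact: key.
rewrite -expR0; apply: continuous_cvg; first exact: continuous_expR.
rewrite -oppr0 -(mul0r v) -(mulr0 e); apply: cvgN; apply: cvgM; last exact: cvg_cst.
by apply: cvgM => //; exact: cvg_cst.
Qed.

(** * Almost sure properties of the paths *)

Section almost_sure.
Context {R : realType} d (T : measurableType d) (P : probability T R).

(** The intersection of the measurable covers is a null set containing [A]; the almost sure path
    properties below are proved by covering their failure in this way. *)
Lemma ae_notin_cvg0 (A : set T) (A_ : nat -> set T) (u : nat -> R) :
  (forall n, measurable (A_ n)) -> (forall n, A `<=` A_ n) ->
  (forall n, (P (A_ n) <= (u n)%:E)%E) -> u @ \oo --> 0 -> {ae P, forall w, ~ A w}.
Proof.
move=> mA_ AA_ Au u0; exists (\bigcap_n A_ n); split.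
- by apply: bigcap_measurableType.
- apply/eqP; rewrite eq_le measure_ge0 andbT.
  have mc : measurable (\bigcap_n A_ n) by apply: bigcap_measurableType.
  rewrite -(@fineK _ (P (\bigcap_n A_ n))) ?fin_num_measure// lee_fin.
  rewrite -(cvg_lim _ u0)//; apply: limr_ge; first exact: cvgP u0.
  apply: nearW => n; rewrite -lee_fin fineK ?fin_num_measure//.
  apply: le_trans (Au n); rewrite le_measure ?inE//; exact: bigcap_inf.
- by move=> w /= /contrapT Aw n _; exact: AA_.
Qed.

Section poisson.
Variables (lambda : R) (N : R -> T -> nat).
Hypotheses (lambda_gt0 : 0 < lambda) (N_poisson : poisson_process P lambda N).

Let mN t : 0 <= t -> measurable_fun setT (N t).
Proof. by case: N_poisson => + _ _ _ _; exact. Qed.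

(** A bounded path would be constant on the integers from some m on, but N(m + j) = N(m) has
    probability e^(-lambda j). *)
Lemma poisson_unbounded : {ae P, forall w, forall n : nat, exists m : nat, (n < N
  m%:R w)%N}.
Proof.
have H (m : nat) : {ae P, forall w, ~ (forall j : nat, N (m + j)%:R w = N m%:R w)}.
  apply: (@ae_notin_cvg0 _ (fun j => [set w | N (m + j)%:R w = N m%:R w])
    (fun j => expR (- lambda) ^+ j)).
  - move=> j; rewrite (_ : [set _ | _] = [set w | N (m + j)%:R w == N m%:R w]).
      by apply: measurable_fun_set; apply: measurable_fun_eqn; exact: mN.
    by apply/seteqP; split => w /= /eqP.
  - by move=> j w; exact.
  - move=> j; rewrite (poisson_no_increment lambda_gt0 N_poisson)// ?ler_nat
      ?leq_addr//.
    by rewrite natrD addrAC subrr add0r -expRM_natl mulrC lexx.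
  - by apply: cvg_expr; rewrite ger0_norm ?expR_ge0// -expR0 ltr_expR oppr_lt0.
apply: filterS (ae_foralln H) => w Hw.
elim=> [|n [m nm]].
  have [j] : exists j : nat, N j%:R w <> N 0%:R w.
    by apply/not_existsP => h; apply: (Hw 0%N) => j; have := h j;
      rewrite add0n => /contrapT.
  case: N_poisson => _ -> _ _ _ /eqP; rewrite -lt0n; by exists j.
have [j] : exists j : nat, N (m + j)%:R w <> N m%:R w.
  by apply/not_existsP => h; apply: (Hw m) => j; have := h j => /contrapT.
move=> /eqP neq; exists (m + j)%N; apply: leq_ltn_trans nm _.
by rewrite ltn_neqAle eq_sym neq (poisson_le N_poisson)// ler_nat leq_addr.
Qed.

Lemma poisson_double_increment (s t : R) : 0 <= s -> s < t ->
  (P [set w | ((N s w).+1 < N t w)%N] <= ((lambda * (t - s)) ^+ 2)%:E)%E.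
Proof.
move=> s0 st; have t0 := ltW (le_lt_trans s0 st).
have [_ _ _ _ pmf] := N_poisson.
pose A k := [set w | (N t w - N s w)%N = k].
have mA k : measurable (A k).
  rewrite (_ : A k = [set w | (N t w - N s w)%N == k]).
    apply: measurable_fun_set; apply: measurable_fun_eqn => //.
    by apply: measurable_fun_subn; exact: mN.
  by apply/seteqP; split => w /= /eqP.
rewrite (_ : [set _ | _] = ~` (A 0%N `|` A 1%N)); last first.
  apply/seteqP; split => w /=.
    by move=> lt [] /eqP; lia.
  have := poisson_le N_poisson w s0 (ltW st); rewrite /A/= => le nA.
  have : (N t w - N s w)%N != 0%N by apply/eqP => h; apply: nA; left.
  have : (N t w - N s w)%N != 1%N by apply/eqP => h; apply: nA; right.
  lia.
have mU : measurable (A 0%N `|` A 1%N) by exact: measurableU.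
have dU : A 0%N `&` A 1%N = set0.
  by apply/seteqP; split => // w []; rewrite /A/= => ->.
rewrite probability_setC// measureU//.
rewrite [leLHS](_ : _ = (1 - (poisson_pmf (lambda * (t - s)) 0 +
    poisson_pmf (lambda * (t - s)) 1))%:E); last first.
  by rewrite EFinB EFinD; congr (_ - (_ + _))%E; exact: pmf.
rewrite /poisson_pmf mulr_gt0 ?subr_gt0//.
rewrite lee_fin expr0 expr1 fact0 invr1 !mul1r mulr1.
set a := lambda * (t - s).
have a0 : 0 < a by rewrite mulr_gt0 ?subr_gt0.
(* From e^(-a) >= 1 - a follows (1 + a) e^(-a) >= 1 - a^2. *)
have := expR_ge1Dx (- a); have := expR_gt0 (- a).
move: (expR _) => e; nra.
Qed.

Definition dyadic (k : nat) : R := 2^-1 ^+ k.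

(** Union bound: K 2^k intervals, each with a double increment of probability at most (lambda
    2^-k)^2, so the total is of order 2^-k. *)
Lemma poisson_simple : {ae P, forall w, forall K : nat, exists k : nat,
  forall j, (j < K * 2 ^ k)%N ->
    (grid N (dyadic k) j.+1 w <= (grid N (dyadic k) j w).+1)%N}.
Proof.
apply: ae_foralln => K.
pose A k j := [set w | ((grid N (dyadic k) j w).+1 < grid N (dyadic k) j.+1 w)%N].
have dy0 k : 0 < dyadic k by rewrite exprn_gt0 ?invr_gt0.
have mA k j : measurable (A k j).
  apply: measurable_fun_set; apply: measurable_fun_ltn; last by apply: mN;
    rewrite mulr_ge0// ltW.
  have := measurable_fun_addn (mN (t := j%:R * dyadic k) _) (@measurable_cst _ _ _ _
    setT 1%N).
  rewrite mulr_ge0 ?(ltW (dy0 k))// => /(_ isT).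
  by under eq_fun do rewrite addn1.
have : {ae P, forall w, ~ (forall k, exists2 j, (j < K * 2 ^ k)%N & A k j w)}.
  apply: (@ae_notin_cvg0 _ (fun k => \bigcup_(j in `I_(K * 2 ^ k)) A k j)
    (fun k => (K%:R * lambda ^+ 2) * 2^-1 ^+ k)).
  - by move=> k; apply: bigcup_measurable.
  - by move=> k w /(_ k)[j jK Aj]; exists j.
  - move=> k; rewrite bigcup_mkord; apply: le_trans (Boole_inequality _ _) _ => //.
    apply: (@le_trans _ _ (\sum_(j < K * 2 ^ k) ((lambda * dyadic k) ^+ 2)%:E)%E).
      apply: lee_sum => j _.
      have dE : dyadic k = j.+1%:R * dyadic k - j%:R * dyadic k by rewrite -natr1; ring.
      rewrite dE; apply: poisson_double_increment; first by rewrite mulr_ge0// ltW.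
      by rewrite ltr_pM2r// ltr_nat.
    rewrite sumEFin lee_fin sumr_const card_ord -[leLHS]mulr_natl natrM natrX.
    rewrite /dyadic le_eqVlt; apply/orP; left; apply/eqP.
    have -> : (2^-1 : R) ^+ k = (2 ^+ k)^-1 by rewrite exprVn.
    by field; rewrite expf_neq0.
  - rewrite -[X in _ --> X](mulr0 (K%:R * lambda ^+ 2)); apply: cvgM;
      first exact: cvg_cst.
    by apply: cvg_expr; rewrite ger0_norm// invf_lt1// ltr1n.
apply: filterS => w /existsNP[k] h; exists k => j jK; rewrite leqNgt; apply/negP => Aj.
by apply: h; exists j.
Qed.
End poisson.

(** Markov's inequality for e^(-D(n)), the transform at s = 1: P(D(n) <= M) <= e^(M - n). *)
Lemma stable_unbounded (beta : R) (D : R -> T -> R) : stable_subordinator P beta D ->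
  {ae P, forall w, forall M : nat, exists n : nat, M%:R < D n%:R w}.
Proof.
move=> [[mD _ _ _ _] _ lap]; apply: ae_foralln => M.
have : {ae P, forall w, ~ (forall n : nat, D n%:R w <= M%:R)}.
  apply: (@ae_notin_cvg0 _ (fun n => [set w | D n%:R w <= M%:R])
    (fun n => expR M%:R * expR (- 1) ^+ n)).
  - move=> n; apply: measurable_fun_set; apply: measurable_fun_ler => //; exact: mD.
  - by move=> n w; exact.
  - move=> n; have mA : measurable [set w | D n%:R w <= M%:R].
      by apply: measurable_fun_set; apply: measurable_fun_ler => //; exact: mD.
    rewrite -[X in (P X <= _)%E]setIT -integral_indic//.
    have := lap 1 n%:R ler01 (ler0n _ _).
    rewrite unlock powR1 mulr1 => lap1.
    have -> : (expR M%:R * expR (-1) ^+ n)%:E =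
        (\int[P]_w ((expR M%:R)%:E * (expR (-1 * D n%:R w))%:E))%E.
      rewrite ge0_integralZl//.
      - by rewrite lap1 EFinM -expRM_natl mulrN1.
      - by apply/measurable_EFinP; apply: measurableT_comp => //;
          apply: measurable_funM => //; exact: mD.
    apply: ge0_le_integral => //.
    - by apply/measurable_EFinP; exact: measurable_indic.
    - apply: measurable_funeM; apply/measurable_EFinP.
      by apply: measurableT_comp => //; apply: measurable_funM => //; exact: mD.
    - move=> w _; rewrite -EFinM lee_fin -expRD indicE.
      case: (boolP (w \in _)) => [|_]; last exact: expR_ge0.
      by rewrite inE/= => DM; apply: (@le_trans _ _ (expR 0));
        [rewrite expR0|rewrite ler_expR; lra].
  - rewrite -[X in _ --> X](mulr0 (expR M%:R)); apply: cvgM; first exact: cvg_cst.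
    by apply: cvg_expr; rewrite ger0_norm ?expR_ge0// -expR0 ltr_expR; lra.
apply: filterS => w /existsNP[n /negP]; rewrite -ltNge => h; by exists n.
Qed.
End almost_sure.

(** * The jump times of the time-changed process *)

Lemma dyadic_gt0 (R : realType) (k : nat) : 0 < dyadic k :> R.
Proof. by rewrite exprn_gt0// invr_gt0. Qed.

Lemma cvg_dyadic (R : realType) : (dyadic k : R) @[k --> \oo] --> 0.
Proof. by apply: cvg_expr; rewrite ger0_norm// invf_lt1// ltr1n. Qed.

Lemma grid_point {R : realType} (r h : R) : 0 <= r -> 0 < h ->
  exists2 j : nat, r <= j%:R * h & j%:R * h <= r + h.
Proof.
move=> r0 h0; exists (Num.truncn (r / h)).+1.
  by rewrite -ler_pdivrMr// ltW// truncnS_gt.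
rewrite -natr1 mulrDl mul1r lerD2r -ler_pdivlMr//.
by rewrite truncn_le divr_ge0// ltW.
Qed.

Section paths.
Context {R : realType} d (T : measurableType d).
Variables (N : R -> T -> nat) (D : R -> T -> R) (w : T).
Hypothesis N_mono : forall w (s t : R), 0 <= s -> s <= t -> (N s w <= N t w)%N.
Hypothesis N0 : N 0 w = 0%N.
Hypothesis N_cadlag : cadlag (fun t => (N t w)%:R : R).
Hypothesis D_le : forall s t : R, 0 <= s -> s <= t -> D s w <= D t w.
Hypothesis D0 : D 0 w = 0.

Let N_le (s t : R) : 0 <= s -> s <= t -> (N s w <= N t w)%N.
Proof. exact: N_mono. Qed.

Lemma right_constant (r : R) : 0 <= r ->
  exists2 e : R, 0 < e & forall s, r <= s -> s < r + e -> N s w = N r w.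
Proof.
move=> r0; have [+ _] := N_cadlag r0.
move=> /cvgrPdist_lt/(_ 1 ltr01)[e /= e0 He].
exists e => // s; rewrite le_eqVlt => /predU1P[-> //|rs] sre.
have : `|(N r w)%:R - (N s w)%:R : R| < 1.
  by apply: He => //=; rewrite ltr_distlC; apply/andP; split; lra.
rewrite ltr_distlC natr1 ltr_nat ltnS => /andP[_ Nsr].
by apply/eqP; rewrite eqn_leq Nsr N_le// ltW.
Qed.

Definition below (i : nat) : set R := [set r | 0 <= r /\ (N r w <= i)%N].

(* The left limit of [D] at the [i.+1]-st jump time of [N]. *)
Definition level_sup (i : nat) : R := sup [set D r w | r in below i].

Lemma below0 i : below i 0.
Proof. by split => //; rewrite N0. Qed.

Hypothesis D_unbounded : forall M : nat, exists n : nat, M%:R < D n%:R w.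

Lemma inverse_process_ge0 (t : R) : 0 <= inverse_process D t w.
Proof.
rewrite /inverse_process; set A := [set r | _].
have [iA|niA] := pselect (has_inf A); last by rewrite inf_out.
by apply: lb_le_inf; [case: iA|move=> r [/ltW]].
Qed.

(** The infimum E(t) need not satisfy D > t itself, but points that do lie arbitrarily close on its
    right, where N still has the value N(E(t)) by right-continuity. *)
Lemma time_change_le (i : nat) (t : R) : 0 <= t ->
  (time_change N (inverse_process D) t w <= i)%N <->
  exists r, [/\ 0 < r, t < D r w & (N r w <= i)%N].
Proof.
move=> t0; rewrite /time_change; set A := [set r | 0 < r /\ t < D r w].
(* Unboundedness of D makes the infimum a genuine one rather than the default 0. *)
have A0 : A !=set0.
  have [n nD] := D_unbounded (Num.truncn t).+1; exists n%:R.
  have tD : t < D n%:R w by apply: lt_trans nD; exact: truncnS_gt.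
  split => //; rewrite ltr0n lt0n; apply/eqP => n0.
  by move: tD; rewrite n0 D0 ltNge t0.
have Alb : has_lbound A by exists 0 => r [/ltW].
have Ainf : has_inf A by split.
have E0 : 0 <= inverse_process D t w by exact: inverse_process_ge0.
split => [Ni|[r [r0 tr Nr]]].
  have [e e0 He] := right_constant E0.
  have [r [r0 tr] re] := inf_adherent e0 Ainf.
  by exists r; split => //; rewrite He//; exact: (ge_inf Alb).
have Er : inverse_process D t w <= r by exact: (ge_inf Alb).
exact: leq_trans (N_le E0 Er) Nr.
Qed.

Section level.
Variable i : nat.
Hypothesis N_gt : exists m : nat, (i < N m%:R w)%N.

Lemma below_bounded : exists m : nat, forall r, below i r -> r < m%:R.
Proof.
have [m im] := N_gt; exists m => r [r0 Nr]; rewrite ltNge; apply/negP => mr.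
by have := leq_trans im (leq_trans (N_le (ler0n _ _) mr) Nr); rewrite ltnn.
Qed.

Lemma has_sup_level : has_sup [set D r w | r in below i].
Proof.
split; first by exists (D 0 w); exists 0 => //; exact: below0.
have [m hm] := below_bounded; exists (D m%:R w) => _ [r br <-].
by apply: D_le; [case: br|apply/ltW/hm].
Qed.

Lemma level_sup_ge (r : R) : below i r -> D r w <= level_sup i.
Proof. by move=> br; apply: ub_le_sup; [case: has_sup_level|exists r]. Qed.

Lemma level_sup_gtP (a : R) : a < level_sup i <-> exists2 r, below i r & a < D r w.
Proof.
split => [ai|[r br ar]]; last exact: lt_le_trans (level_sup_ge br).
have e0 : 0 < level_sup i - a by rewrite subr_gt0.
have [_ [r br <-]] := sup_adherent e0 has_sup_level.
by rewrite -/(level_sup i) subKr => ar; exists r.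
Qed.

Lemma level_sup_ge0 : 0 <= level_sup i.
Proof. by rewrite -[leLHS]D0; exact: level_sup_ge (below0 i). Qed.

Lemma time_change_leP (t : R) : 0 <= t ->
  (time_change N (inverse_process D) t w <= i)%N <-> t < level_sup i.
Proof.
move=> t0; rewrite time_change_le// level_sup_gtP; split.
  by move=> [r [r0 tr Nr]]; exists r => //; split => //; exact: ltW.
move=> [r [r0 Nr] tr]; exists r; split => //; rewrite lt_neqAle r0 andbT.
by apply/eqP => r00; move: tr; rewrite -r00 D0 ltNge t0.
Qed.

Lemma jump_time_level :
  jump_time (time_change N (inverse_process D)) i.+1 w = level_sup i.
Proof.
rewrite /jump_time (_ : [set _ | _] = `]0, (level_sup i)[%classic); last first.
  apply/seteqP; split => t /=; rewrite in_itv/= ltnS.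
    by move=> [t0 /(time_change_leP (ltW t0)) ->]; rewrite t0.
  by move=> /andP[t0 tl]; split => //; apply/(time_change_leP (ltW t0)).
(* When the level is 0 the interval is empty, and the default value of [sup] is again 0. *)
have := level_sup_ge0; rewrite le_eqVlt => /predU1P[<-|l0]; last first.
  by rewrite sup_itv// bnd_simp.
by rewrite set_itvoo0 sup0.
Qed.

(** A countable description, which yields measurability of the jump times. A grid point just after r
    has the same value of N and at least the same value of D. *)
Lemma level_sup_grid (a : R) : a < level_sup i <->
  exists k j : nat, (grid N (dyadic k) j w <= i)%N /\ a < grid D (dyadic k) j w.
Proof.
rewrite level_sup_gtP; split => [[r [r0 Nr] ar]|[k [j [Nj aj]]]]; last first.
  by exists (j%:R * dyadic k) => //; split => //; rewrite mulr_ge0// exprn_ge0.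
have [e e0 He] := right_constant r0.
have [k ke] : exists k, dyadic k < e.
  have : \forall k \near \oo, (dyadic k : R) < e by apply: (cvgr_lt 0);
    [exact: cvg_dyadic|exact: e0].
  by move=> [k _ /(_ k (leqnn k))]; exists k.
have [j rj jr] := grid_point r0 (dyadic_gt0 R k).
exists k, j; rewrite /grid; split; first by rewrite He// (le_lt_trans jr)// ltrD2l.
by apply: lt_le_trans ar _; exact: D_le.
Qed.

End level.

Lemma grid_mono (k : nat) v (i j : nat) : (i <= j)%N ->
  (grid N (dyadic k : R) i v <= grid N (dyadic k : R) j v)%N.
Proof.
move=> ij; have dk := ltW (@dyadic_gt0 R k).
by apply: N_mono; rewrite ?mulr_ge0// ler_wpM2r// ler_nat.
Qed.

Let grid_le (k i j : nat) : (i <= j)%N ->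
  (grid N (dyadic k : R) i w <= grid N (dyadic k : R) j w)%N.
Proof. exact: grid_mono. Qed.

Lemma grid_dyadicS (k j : nat) :
  grid N (dyadic k : R) j w = grid N (dyadic k.+1 : R) j.*2 w.
Proof.
rewrite /grid; congr (N _ w).
by rewrite /dyadic exprS -mul2n natrM; field.
Qed.

Definition simple_upto (K k : nat) := forall j, (j < K * 2 ^ k)%N ->
  (grid N (dyadic k : R) j.+1 w <= (grid N (dyadic k : R) j w).+1)%N.

(** A finer interval lies inside a coarser one, so its increment is no larger. *)
Lemma simple_uptoS K k : simple_upto K k -> simple_upto K k.+1.
Proof.
move=> sk j jK.
have jlt : (j./2 < K * 2 ^ k)%N.
  by rewrite ltn_half_double -mul2n mulnCA -expnS.
apply: leq_trans (_ : (grid N (dyadic k : R) j./2.+1 w <= _)%N).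
  by rewrite (grid_dyadicS k j./2.+1); apply: grid_le; lia.
apply: leq_trans (sk _ jlt) _; rewrite ltnS (grid_dyadicS k j./2); apply: grid_le; lia.
Qed.

Lemma simple_upto_leq K k k' : (k <= k')%N -> simple_upto K k -> simple_upto K k'.
Proof.
move=> /subnK <-; elim: (k' - k)%N => // l ih sk.
by rewrite addSn; apply: simple_uptoS; exact: ih.
Qed.

Lemma gridE_nat (K k : nat) : grid N (dyadic k : R) (K * 2 ^ k) w = N K%:R w.
Proof. by rewrite /grid natrM natrX -mulrA -exprMn divff// expr1n mulr1. Qed.

Hypothesis N_unbounded : forall n : nat, exists m : nat, (n < N m%:R w)%N.

Lemma unbounded_dyadic (k : nat) : unbounded N (dyadic k : R) w.
Proof.
move=> m; have [K mK] := N_unbounded m.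
by exists (K * 2 ^ k)%N; rewrite gridE_nat.
Qed.

(** When every marked interval before time K raises N by exactly one, counting marks is counting
    jumps. *)
Lemma grid_start (n K k : nat) : (n < N K%:R w)%N -> simple_upto K k ->
  forall i, (i <= n)%N -> grid N (dyadic k : R) (start N (dyadic k : R) i w) w = i /\
    grid N (dyadic k : R) (random_mark N (dyadic k : R) i.+1 w) w = i /\
    (i < grid N (dyadic k : R) (random_mark N (dyadic k : R) i.+1 w).+1 w)%N.
Proof.
move=> nK sk.
have step i : (i <= n)%N -> grid N (dyadic k : R) (start N (dyadic k : R) i w) w = i ->
    grid N (dyadic k : R) (random_mark N (dyadic k : R) i.+1 w) w = i /\
    (i < grid N (dyadic k : R) (random_mark N (dyadic k : R) i.+1 w).+1 w)%N.
  move=> i_n si; have [] := gapP (@grid_mono k) (start N (dyadic k : R) i w)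
    (unbounded_dyadic k).
  by rewrite /random_mark /= /block_end -startE -/(random_gap N (dyadic k : R) i w)
    si => ->.
have st i : (i <= n)%N -> grid N (dyadic k : R) (start N (dyadic k : R) i w) w = i.
  elim: i => [_|i ih i_n]; first by rewrite /= /grid mul0r N0.
  have {}ih := ih (ltnW i_n); have [mi lt] := step i (ltnW i_n) ih.
  have eS : start N (dyadic k : R) i.+1 w = (random_mark N (dyadic k : R) i.+1 w).+1.
    by rewrite /random_mark /= /block_end -startE.
  rewrite eS; apply/eqP; rewrite eqn_leq lt andbT -{2}mi; apply: sk.
  (* Simplicity is available at this mark: N equals i < n there and exceeds n at K, so the mark
     precedes time K. *)
  rewrite ltnNge; apply/negP => /(grid_le k); rewrite gridE_nat mi => Ni.
  by have := leq_trans nK Ni; rewrite leqNgt ltnW// ltnS ltnW.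
by move=> i i_n; split; [exact: st|exact: step (st _ i_n)].
Qed.

Hypothesis N_simple : forall K : nat, exists k : nat, simple_upto K k.

(** From above, N = i at the mark keeps D below the supremum. From below, take r with N(r) <= i and
    D(r) nearly the supremum: a grid point shortly after r still has N <= i, hence is not beyond the
    mark. *)
Lemma cvg_random_mark (i : nat) :
  grid D (dyadic k : R) (random_mark N (dyadic k : R) i.+1 w) w @[k --> \oo] -->
  level_sup i.
Proof.
apply/cvgrPdist_le => e e0.
have [K iK] := N_unbounded i; have [k0 sk0] := N_simple K.
have le0 : level_sup i - e < level_sup i by rewrite ltrBlDr ltrDl.
have [r [r0 Nr] er] := (level_sup_gtP (N_unbounded i) _).1 le0.
have [dl dl0 Hdl] := right_constant r0.
near=> k.
have kd : dyadic k < dl by near: k; apply: (cvgr_lt 0); [exact: cvg_dyadic|exact: dl0].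
have k0k : (k0 <= k)%N by near: k; exact: nbhs_infty_ge.
have [_ [Ni Ni1]] := grid_start iK (simple_upto_leq k0k sk0) (leqnn i).
set m := random_mark _ _ _ _ in Ni Ni1 *.
have dk := @dyadic_gt0 R k.
have m0 : 0 <= m%:R * dyadic k :> R by rewrite mulr_ge0// ltW.
have up : grid D (dyadic k : R) m w <= level_sup i.
  by apply: level_sup_ge => //; split => //; rewrite -Ni.
rewrite ger0_norm ?subr_ge0// lerBlDr -lerBlDl; apply: le_trans (ltW er) _.
have [j rj jr] := grid_point r0 dk.
have Nj : (grid N (dyadic k : R) j w <= i)%N.
  by rewrite /grid Hdl// (le_lt_trans jr)// ltrD2l.
have jm : (j <= m)%N.
  by rewrite leqNgt; apply/negP => /(grid_le k) mj;
    have := leq_trans Ni1 (leq_trans mj Nj); rewrite ltnn.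
apply: (@le_trans _ _ (grid D (dyadic k : R) j w)); first exact: D_le.
by apply: D_le; [rewrite mulr_ge0// ltW|rewrite ler_wpM2r ?ler_nat ?(ltW dk)].
Unshelve. all: by end_near. Qed.

Lemma cvg_spacing (i : nat) :
  spacing N D (dyadic k : R) i w @[k --> \oo] -->
  waiting_time (time_change N (inverse_process D)) i w.
Proof.
rewrite /spacing; case: i => [|i] /=.
  rewrite jump_time_level// -[X in _ --> X]subr0; apply: cvgB;
    first exact: cvg_random_mark.
  rewrite /random_mark /= /grid.
  by under eq_fun do rewrite mul0r D0; exact: cvg_cst.
by rewrite !jump_time_level//; apply: cvgB; exact: cvg_random_mark.
Qed.

Lemma waiting_time_ge0 (i : nat) :
  0 <= waiting_time (time_change N (inverse_process D)) i w.
Proof.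
case: i => [|i] /=; rewrite !jump_time_level// ?level_sup_ge0// subr_ge0.
apply: ge_sup; first by exists (D 0 w); exists 0 => //; exact: below0.
by move=> _ [r [r0 Nr] <-]; apply: level_sup_ge => //; split => //; exact: leqW.
Qed.

Lemma sum_waiting_time (m : nat) (t : R) : 0 <= t ->
  \sum_(i < m) waiting_time (time_change N (inverse_process D)) i w <= t <->
  (m <= time_change N (inverse_process D) t w)%N.
Proof.
move=> t0; case: m => [|m]; first by rewrite big_ord0 t0.
have -> : \sum_(i < m.+1) waiting_time (time_change N (inverse_process D)) i w =
  level_sup m.
  elim: m => [|m ih]; first by rewrite big_ord1 /= jump_time_level.
  by rewrite big_ord_recr ih /= !jump_time_level// subrKC.
have [h1 h2] := time_change_leP (N_unbounded m) t0.
rewrite leNgt [X in _ <-> is_true X]ltnNge.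
by split => /negP h; apply/negP => ?; apply: h; [exact: h1|exact: h2].
Qed.

End paths.

(** * Measurability of the waiting times *)

Section jump_time_measurable.
Context {R : realType} d (T : measurableType d).
Variables (N : R -> T -> nat) (D : R -> T -> R).
Hypothesis mN : forall t, 0 <= t -> measurable_fun setT (N t).
Hypothesis mD : forall t, 0 <= t -> measurable_fun setT (D t).
Hypothesis N_mono : forall w (s t : R), 0 <= s -> s <= t -> (N s w <= N t w)%N.
Hypothesis N0 : forall w, N 0 w = 0%N.
Hypothesis N_cadlag : forall w, cadlag (fun t => (N t w)%:R : R).
Hypothesis D_le : forall w (s t : R), 0 <= s -> s <= t -> D s w <= D t w.
Hypothesis D0 : forall w, D 0 w = 0.
Local Notation tau := (jump_time (time_change N (inverse_process D))).

(** On exceptional paths the set of times is unbounded and [sup] defaults to 0. This makes the jump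
    times measurable on the whole space and not only almost everywhere defined. *)
Lemma jump_time_out (i : nat) (w : T) :
  ~ ((forall M : nat, exists n : nat, M%:R < D n%:R w) /\
     (exists m : nat, (i < N m%:R w)%N)) -> tau i.+1 w = 0.
Proof.
move=> out; apply: sup_out => -[_ [b bS]].
(* If D stays below M, then E(t) is the default 0 for t > M, where N vanishes; if N never exceeds i,
   every t qualifies. *)
suff [t [t0 bt le]] : exists t : R, [/\ 0 < t, b < t & 
    (time_change N (inverse_process D) t w <= i)%N].
  by have := bS t; rewrite leNgt bt => /(_ (conj t0 le)).
move: out => /not_andP[/existsNP[M hM]|nN].
  have DM (r : R) : 0 <= r -> D r w <= M%:R.
    move=> r0; rewrite leNgt; apply/negP => MD; apply: hM; exists (Num.truncn r).+1.
    by apply: lt_le_trans MD _; apply: D_le => //; apply/ltW; exact: truncnS_gt.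
  exists (Num.max b M%:R + 1).
  have Mt : M%:R < Num.max b M%:R + 1 by rewrite ltr_pwDr// le_max lexx orbT.
  split; [exact: le_lt_trans Mt|by rewrite ltr_pwDr// le_max lexx|].
  rewrite /time_change /inverse_process (_ : [set _ | _] = set0) ?inf0 ?N0//.
  apply/seteqP; split => // r [r0 tr].
  by have := lt_trans Mt (lt_le_trans tr (DM _ (ltW r0))); rewrite ltxx.
exists (`|b| + 1); split; first by rewrite ltr_wpDl.
  by rewrite ltr_pwDr// ler_norm.
rewrite /time_change; set E := inverse_process _ _ _.
have E0 : 0 <= E by exact: inverse_process_ge0.
apply: (@leq_trans (N (Num.truncn E).+1%:R w)).
  by apply: N_mono => //; apply/ltW; exact: truncnS_gt.
by rewrite leqNgt; apply/negP => iN; apply: nN; exists (Num.truncn E).+1.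
Qed.

Lemma measurable_jump_time (n : nat) : measurable_fun setT (tau n).
Proof.
case: n => [|i].
  rewrite (_ : tau 0 = cst 0); first exact: measurable_cst.
  apply/funext => w; rewrite /jump_time (_ : [set _ | _] = set0) ?sup0//.
  by apply/seteqP; split => // t [_].
pose good : set T := (\bigcap_(M : nat) \bigcup_(n : nat) [set w | M%:R < D n%:R w]) `&`
  \bigcup_(m : nat) [set w | (i < N m%:R w)%N].
have mgood : measurable good.
  apply: measurableI.
    apply: bigcap_measurableType => M _; apply: bigcup_measurable => n _.
    by apply: measurable_fun_set; apply: measurable_fun_ltr => //; exact: mD.
  apply: bigcup_measurable => m _.
  by apply: measurable_fun_set; apply: measurable_fun_ltn => //; exact: mN.
have goodP w : good w <-> (forall M : nat, exists n : nat, M%:R < D n%:R w) /\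
     (exists m : nat, (i < N m%:R w)%N).
  split => -[h1 h2]; split.
  - by move=> M; have [n] := h1 M I; exists n.
  - by have [m] := h2; exists m.
  - by move=> M _; have [n] := h1 M; exists n.
  - by have [m] := h2; exists m.
move=> _; apply: (measurability _ (RGenOInfty.measurableE R)) => // _ [_ [a ->] <-].
rewrite setTI (_ : _ @^-1` _ = (good `&` \bigcup_k \bigcup_j
    ([set w | (grid N (dyadic k : R) j w <= i)%N] `&` [set w | a < grid D (dyadic k :
      R) j w]))
  `|` (~` good `&` [set _ | a < 0])).
  have dk k j : 0 <= j%:R * dyadic k :> R by rewrite mulr_ge0// ltW// dyadic_gt0.
  apply: measurableU; apply: measurableI => //;
    [|exact: measurableC|exact: measurable_set_cst].
  apply: bigcup_measurable => k _; apply: bigcup_measurable => j _.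
  apply: measurableI; apply: measurable_fun_set.
    by apply: measurable_fun_leq => //; exact: mN.
  by apply: measurable_fun_ltr => //; exact: mD.
apply/seteqP; split => w /=; rewrite in_itv/= andbT.
  have [/[dup] gw /goodP[Du Nm]|ng] := pselect (good w).
    rewrite (jump_time_level N_mono (N0 w) (N_cadlag w) (@D_le w) (D0 w) Du Nm).
    move=> /(level_sup_grid N_mono (N0 w) (N_cadlag w) (@D_le w) Nm)[k [j [kj aj]]].
    by left; split => //; exists k => //; exists j.
  by rewrite jump_time_out; [right|move/goodP].
move=> [[/goodP[Du Nm] [k _ [j _ [kj aj]]]]|[ng a0]].
  rewrite (jump_time_level N_mono (N0 w) (N_cadlag w) (@D_le w) (D0 w) Du Nm).
  by apply/(level_sup_grid N_mono (N0 w) (N_cadlag w) (@D_le w) Nm); exists k, j.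
by rewrite jump_time_out// => /goodP.
Qed.

Lemma measurable_waiting_time (n : nat) :
  measurable_fun setT (waiting_time (time_change N (inverse_process D)) n).
Proof.
by case: n => [|n]; [|apply: measurable_funB]; exact: measurable_jump_time.
Qed.

End jump_time_measurable.

(** * Passage to the limit *)

Lemma cvg_prode {R : realType} (n : nat) (u : nat -> nat -> \bar R) (l : nat -> \bar
  R) :
  (forall i, l i \is a fin_num) -> (forall i, u i k @[k --> \oo] --> l i) ->
  (\prod_(i < n) u i k)%E @[k --> \oo] --> (\prod_(i < n) l i)%E.
Proof.
move=> lfin ul; elim: n => [|n ih].
  by rewrite big_ord0; under eq_fun do rewrite big_ord0; exact: cvg_cst.
rewrite big_ord_recr /=; under eq_fun do rewrite big_ord_recr /=.
by apply: cvgeM => //; rewrite mule_def_fin//; apply: prode_fin_num.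
Qed.

Section time_changed_poisson.
Context {R : realType} d (T : measurableType d) (P : probability T R).
Variables (beta lambda : R) (N : R -> T -> nat) (D : R -> T -> R).
Hypotheses (beta_gt0 : 0 < beta) (lambda_gt0 : 0 < lambda).
Hypothesis N_poisson : poisson_process P lambda N.
Hypothesis D_stable : stable_subordinator P beta D.
Hypothesis N_D_indep : independent_processes P N D.
Local Notation M := (time_change N (inverse_process D)).
Local Notation X := (waiting_time M).
Local Notation Y k := (spacing N D (dyadic k : R)).

Let mN (t : R) : 0 <= t -> measurable_fun setT (N t).
Proof. by case: N_poisson => + _ _ _ _; exact. Qed.

Let N0 w : N 0 w = 0%N.
Proof. by case: N_poisson. Qed.

Let N_mono w (s t : R) : 0 <= s -> s <= t -> (N s w <= N t w)%N.
Proof. exact: (poisson_le N_poisson). Qed.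

Let N_cadlag w : cadlag (fun t => (N t w)%:R : R).
Proof. by case: N_poisson => _ _ /(_ w)[]. Qed.

Let D_levy : levy_process P D.
Proof. by case: D_stable. Qed.

Let mD (t : R) : 0 <= t -> measurable_fun setT (D t).
Proof. by case: D_levy => + _ _ _ _; exact. Qed.

Let D_zero w : D 0 w = 0.
Proof. by case: D_levy. Qed.

Let D_le w (s t : R) : 0 <= s -> s <= t -> D s w <= D t w.
Proof. by case: D_stable => _ + _; exact. Qed.

Let dy0 k : 0 < dyadic k :> R.
Proof. exact: dyadic_gt0. Qed.

Let mX i : measurable_fun setT (X i).
Proof. exact: measurable_waiting_time. Qed.

Let mgrid {S : Type} (Z : R -> T -> S) (Q : (T -> S) -> Prop) :
  (forall t, 0 <= t -> Q (Z t)) -> forall k j, Q (grid Z (dyadic k : R) j).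
Proof. by move=> H k j; apply: H; rewrite mulr_ge0// ltW. Qed.

Let mY k i : measurable_fun setT (Y k i).
Proof.
apply: measurable_spacing; [exact: (mgrid mN)|exact: (mgrid mD)|].
exact: grid_poisson_le N_poisson (dy0 k).
Qed.

Let good : {ae P, forall w, [/\ forall m : nat, exists n : nat, m%:R < D n%:R w,
  forall n : nat, exists m : nat, (n < N m%:R w)%N &
  forall K : nat, exists k : nat, simple_upto N w K k]}.
Proof.
have := poisson_simple lambda_gt0 N_poisson.
have := poisson_unbounded lambda_gt0 N_poisson.
have := stable_unbounded D_stable.
by apply: filterS3 => w Du Nu Ns; split.
Qed.

Let unboundedP k : {ae P, forall w, unbounded N (dyadic k : R) w}.
Proof. by apply: filterS good => w [_ Nu _]; exact: unbounded_dyadic. Qed.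

Let YX : {ae P, forall w, forall i, Y k i w @[k --> \oo] --> X i w}.
Proof.
apply: filterS good => w [Du Nu Ns] i.
exact: (cvg_spacing N_mono (N0 w) (N_cadlag w) (@D_le w) (D_zero w) Du Nu Ns).
Qed.

Let X_ge0 : {ae P, forall w, forall i, 0 <= X i w}.
Proof. by apply: filterS good => w [Du Nu Ns] i;
  exact: (waiting_time_ge0 N_mono (N0 w) (N_cadlag w) (@D_le w) (D_zero w) Du Nu). Qed.

Let Y_ge0 k i w : 0 <= Y k i w.
Proof.
rewrite subr_ge0; apply: D_le; first by rewrite mulr_ge0// ltW.
by rewrite ler_wpM2r ?(ltW (dy0 k))// ler_nat /random_mark mark_timeS leq_addr.
Qed.

(** Default values may make a waiting time negative on a null set, whereas [tail_mittag_leffler]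
    asks for nonnegativity everywhere, hence the truncation at 0. *)
Let laplace_X i (s : R) : 0 < s ->
  (\int[P]_w (expR (- s * Num.max 0 (X i w)))%:E =
   (lambda / (lambda + s `^ beta))%:E)%E.
Proof.
move=> s0.
have mexp (Z : T -> R) : measurable_fun setT Z -> measurable_fun setT (fun w => expR
  (- s * Z w)).
  by move=> mZ; apply: measurableT_comp => //; exact: measurable_funM.
have c1 : (\int[P]_w (expR (- s * Y k i w))%:E)%E @[k --> \oo] -->
    (\int[P]_w (expR (- s * Num.max 0 (X i w)))%:E)%E.
  apply: (@dominated_cvg _ _ _ P setT (fun k w => expR (- s * Y k i w)) _ (cst 1)) =>
    //.
  - by move=> k; exact: mexp.
  - by apply: mexp; exact: measurable_maxr.
  - apply: filterS2 YX X_ge0 => w YXw Xw _; rewrite max_r//.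
    apply: continuous_cvg; first exact: continuous_expR.
    by apply: cvgMr; exact: YXw.
  - exact: finite_measure_integrable_cst.
  - move=> k w _; rewrite ger0_norm ?expR_ge0// -[leRHS]expR0 ler_expR mulNr oppr_le0.
    by rewrite mulr_ge0// ltW.
refine (cvg_unique (@ereal_hausdorff _) c1 _).
rewrite (_ : (fun k => _) = EFin \o (fun k => (1 - expR (- lambda * dyadic k)) *
    expR (- ((0 < i)%N%:R * dyadic k * s `^ beta)) /
    (1 - expR (- (lambda + s `^ beta) * dyadic k)))); last first.
  apply/funext => k.
  exact: (laplace_spacing lambda_gt0 N_poisson D_stable N_D_indep (dy0 k)
    (unboundedP k) i (ltW s0)).
apply: cvg_EFin; first exact: nearW.
apply: cvg_laplace_ratio => //; first exact: powR_ge0.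
exact: cvg_dyadic.
Qed.

Let tail_X i (t : R) : 0 <= t ->
  P [set w | t < X i w] = (mittag_leffler beta (- lambda * t `^ beta))%:E.
Proof.
move=> t0; rewrite -(@tail_mittag_leffler _ _ _ P (fun w => Num.max 0 (X i w)) _ _
  beta lambda)//.
- congr (P _); apply/seteqP; split => w /=; rewrite lt_max; first by move=> ->;
    rewrite orbT.
  by rewrite ltNge t0.
- exact: measurable_maxr.
- by move=> w; rewrite le_max lexx.
- by move=> s s0; exact: laplace_X.
Qed.

(** An atom at a < 0 contradicts nonnegativity, one at 0 contradicts E_beta(0) = 1, one at a > 0
    contradicts continuity of the tail. *)
Let X_neq i (a : R) : {ae P, forall w, X i w <> a}.
Proof.
have [a0|] := ltP a 0.
  by apply: filterS X_ge0 => w /(_ i) + Xa; rewrite Xa leNgt a0.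
have mgt t : measurable [set w | t < X i w] by exact: measurable_tail_set.
rewrite le_eqVlt => /predU1P[<-|a0].
  apply: (@ae_notin_cvg0 _ _ _ P [set w | X i w = 0] (fun=> ~` [set w | 0 < X i w])
    (fun=> 0)).
  - by move=> _; exact: measurableC.
  - by move=> _ w /= ->; rewrite ltxx.
  - move=> _; rewrite probability_setC// tail_X// powR0 ?gt_eqF// mulr0.
    by rewrite mittag_leffler0// subee.
  - exact: cvg_cst.
(* These points increase to [a] from strictly below and stay nonnegative, where the tail formula
   holds. *)
pose ak k := a - a * dyadic k.
have ak0 k : 0 <= ak k.
  by rewrite subr_ge0 ger_pMr// exprn_ile1// invf_le1// ler1n.
have aka k : ak k < a by rewrite ltrBlDr ltrDl mulr_gt0.
pose F t := mittag_leffler beta (- lambda * t `^ beta).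
apply: (@ae_notin_cvg0 _ _ _ P [set w | X i w = a]
  (fun k => [set w | ak k < X i w] `\` [set w | a < X i w]) (fun k => F (ak k) - F a)).
- by move=> k; exact: measurableD.
- by move=> k w /= ->; rewrite ltxx; split.
- move=> k; rewrite measureD//=.
    rewrite setIidr; last by move=> w /=; exact: lt_trans.
    by rewrite !tail_X// ?(ltW a0)// -EFinB.
  by rewrite tail_X// ltry.
- rewrite -(subrr (F a)); apply: cvgB; last exact: cvg_cst.
  apply: (@continuous_cvg _ _ _ _ _ _ (mittag_leffler beta)).
    exact: continuous_mittag_leffler.
  apply: cvgMr.
  have /continuous_within_itvcyP[c1 _] := continuous_powR_ge0 (ltW beta_gt0).
  apply: (@continuous_cvg _ _ _ _ _ _ (fun u : R => u `^ beta)); first by apply: c1;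
    rewrite in_itv/= a0.
  rewrite -[X in _ --> X]subr0; apply: cvgB; first exact: cvg_cst.
  by rewrite -(mulr0 a); apply: cvgMr; exact: cvg_dyadic.
Qed.

(** The limit almost surely avoids the endpoint of the half-line, so membership stabilises along the
    sequence. *)
Let eventually_ray i (B : set R) : ray_system B ->
  {ae P, forall w, \forall k \near \oo, B (Y k i w) <-> B (X i w)}.
Proof.
move=> [->|[a ->]]; first by apply: aeW => w; exact: nearW.
apply: filterS2 YX (X_neq i a) => w YXw Xa.
have {}YXw := YXw i.
have [aX|] := ltP a (X i w).
  have : \forall k \near \oo, a < Y k i w by exact: (cvgr_gt (X i w) YXw).
  by apply: filterS => k aY; rewrite /= !in_itv/= aY aX.
rewrite le_eqVlt => /predU1P[//|Xa'].
have : \forall k \near \oo, Y k i w < a by exact: (cvgr_lt (X i w) YXw).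
by apply: filterS => k Ya; rewrite /= !in_itv/= !ltNge !ltW.
Qed.

Let independent_X : mutually_independent P X.
Proof.
apply: mutually_independent_rays => // n B rB.
have mB i : measurable (B i) by rewrite measurable_ray_system; exact: sub_sigma_algebra.
have c1 : P [set w | forall i, (i < n)%N -> B i (Y k i w)] @[k --> \oo] -->
    P [set w | forall i, (i < n)%N -> B i (X i w)].
  apply: cvg_probability.
  - by move=> k; exact: (@measurable_cyl _ _ _ (Y k)).
  - exact: measurable_cyl.
  - have : {ae P, forall w, forall i, \forall k \near \oo, B i (Y k i w) <-> B i (X i
      w)}.
      by apply: ae_foralln => i; exact: eventually_ray.
    apply: filterS => w Hw.
    have : \forall k \near \oo, forall i : 'I_n, B i (Y k i w) <-> B i (X i w).
      by apply: filter_forall => i; exact: Hw.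
    apply: filterS => k Hk; split => H i i_n;
      [exact: (Hk (Ordinal i_n)).1 (H i i_n)|exact: (Hk (Ordinal i_n)).2 (H i i_n)].
have c2 i : P (Y k i @^-1` B i) @[k --> \oo] --> P (X i @^-1` B i).
  apply: cvg_probability; last exact: eventually_ray.
  - by move=> k; exact: measurable_preimageT.
  - exact: measurable_preimageT.
refine (cvg_unique (@ereal_hausdorff _) c1 _).
rewrite (_ : (fun k => _) = (fun k => (\prod_(i < n) P (Y k i @^-1` B i))%E));
  last first.
  apply/funext => k.
  rewrite (spacings_probability lambda_gt0 N_poisson D_levy N_D_indep (dy0 k)
    (unboundedP k))//.
  apply: eq_bigr => i _.
  by rewrite (spacing_probability lambda_gt0 N_poisson D_levy N_D_indep (dy0 k)
    (unboundedP k)).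
apply: (@cvg_prode _ n (fun i k => P (Y k i @^-1` B i)) (fun i => P (X i @^-1` B i)))
  => //.
by move=> i; rewrite fin_num_measure//; exact: measurable_preimageT.
Qed.

Lemma iid_mittag_leffler_waiting_time : iid_mittag_leffler P beta lambda X.
Proof. by split. Qed.

Lemma fractional_poisson_time_change : fractional_poisson_process P beta lambda M.
Proof.
exists X; split; first exact: iid_mittag_leffler_waiting_time.
apply: filterS good => w [Du Nu Ns] t t0.
have S m := sum_waiting_time N_mono (N0 w) (N_cadlag w) (@D_le w) (D_zero w) Du Nu m t0.
by split; [exact/S|move=> m /S].
Qed.

End time_changed_poisson.

Theorem theorem2p2 (R : realType) (d : measure_display) (T : measurableType d)
    (P : probability T R) (beta lambda : R)
    (N1 : R -> T -> nat) (D : R -> T -> R)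
    (beta_gt0 : 0 < beta) (beta_lt1 : beta < 1) (lambda_gt0 : 0 < lambda)
    (N1_poisson : poisson_process P lambda N1)
    (D_stable : stable_subordinator P beta D)
    (N1_D_indep : independent_processes P N1 D) :
  let N := time_change N1 (inverse_process D) in
  fractional_poisson_process P beta lambda N /\
  iid_mittag_leffler P beta lambda (waiting_time N).
Proof.
split; first exact: fractional_poisson_time_change.
exact: iid_mittag_leffler_waiting_time.
Qed.
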